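(* Let $X$ be a tropical curve with a polarization $\mu$ of degree $d$, and let $p_0$ be a point of $X$. There is a refinement map of polyhedral complexes $J^{\mathrm{trop}}_{p_0,\mu}(X)\to P^{\mathrm{trop}}_\mu(X)$, where $J^{\mathrm{trop}}_{p_0,\mu}(X)$ is the Jacobian of $X$ with respect to $(p_0,\mu)$ and $P^{\mathrm{trop}}_\mu(X)$ is the $\mu$-polystable Jacobian of $X$.
   Context: Graphs. Graphs are finite, with loops and multiple edges allowed. For $\mathcal E\subset E(\Gamma)$: $\Gamma_{\mathcal E}$ is $\Gamma$ with the edges of $\mathcal E$ removed; $\Gamma^{\mathcal E}$ is $\Gamma$ with one new (exceptional) vertex $v_e$ inserted in the interior of each $e\in\mathcal E$. If $\Gamma$ is oriented, $s(e),t(e)$ are the source and target of $e$, and $e^s,e^t$ are the two edges of $\Gamma^{\mathcal E}$ over $e\in\mathcal E$ adjacent to $s(e)$ and $t(e)$ respectively. For $V\subset V(\Gamma)$, $E(V,V^c)$ is the set of edges joining $V$ to its complement and $\delta_{\Gamma,V}=|E(V,V^c)|$. $\mathrm{val}_{\mathcal E}(v)$ is the number of edges of $\mathcal E$ incident to $v$, loops counted twice. Tropical curves. A tropical curve is a connected metric space $X$ obtained from a finite connected weighted graph $\Gamma$ (weights $w\colon V(\Gamma)\to\mathbb Z_{\ge0}$) and lengths $\ell\colon E(\Gamma)\to\mathbb R_{>0}$ by gluing segments of length $\ell(e)$ according to $\Gamma$ (a model of $X$), with the weight function extended by zero to $w_X$. A degree-$d$ polarization on $X$ ($d\in\mathbb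 Z$) is a finitely supported $\mu\colon X\to\mathbb R$ with $\sum_p\mu(p)=d$. The $\mu$-model of $X$ is the model whose vertices are the points $p$ with valence $\ne2$, or $w_X(p)\ne0$, or $\mu(p)\ne0$ (this set is assumed nonempty). Models are given a fixed orientation. Stability. A pseudo-divisor on a model $\Gamma$ is a pair $(\mathcal E,D)$ with $\mathcal E\subset E(\Gamma)$ and $D\colon V(\Gamma^{\mathcal E})\to\mathbb Z$ with $D(v_e)=-1$ for all $e\in\mathcal E$; its degree is the sum of the values of $D$. For $(\mathcal E,D)$ of degree $d$ and $V\subset V(\Gamma)$ put $$\beta_{\mathcal E,D}(V)=\sum_{v\in V}D(v)-\sum_{v\in V}\Bigl(\mu(v)+\tfrac12\mathrm{val}_{\mathcal E}(v)\Bigr)+\tfrac12\delta_{\Gamma_{\mathcal E},V}.$$ $(\mathcal E,D)$ is $\mu$-polystable if $\beta_{\mathcal E,D}(V)\ge0$ for every $V$, with strict inequality whenever $E(V,V^c)\not\subset\mathcal E$. If $p_0\in V(\Gamma)$, $(\mathcal E,D)$ is $(p_0,\mu)$-quasistable if $\beta_{\mathcal E,D}(V)\ge0$ for every $V\subsetneq V(\Gamma)$, with strict inequality if $p_0\in V$. A specialization $(\mathcal E_1,D_1)\to(\mathcal E_2,D_2)$ of pseudo-divisors on $\Gamma$ consists of an inclusion $\mathcal E_2\subset\mathcal E_1$ and, for each $e\in\mathcal E_1\setminus\mathcal E_2$, a choice of one of the two edges $e^s,e^t$ of $\Gamma^{\mathcal E_1}$, such that contracting the chosen edges takes $D_1$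 to $D_2$ (values being summed over identified vertices). Polytopes. $K_{\mathcal E,D}(X)=\prod_{e\in\mathcal E}[0,\ell(e)]\subset\mathbb R^{\mathcal E}$. Let $L_{\mathcal E}\subset\mathbb R^{\mathcal E}$ be the span of the vectors $u_V=\sum_{e\in\mathcal E,\,s(e)\in V,\,t(e)\in V^c}u_e-\sum_{e\in\mathcal E,\,t(e)\in V,\,s(e)\in V^c}u_e$ for all $V\subset V(\Gamma)$ with $E(V,V^c)\subset\mathcal E$ ($u_e$ the standard basis), and let $P_{\mathcal E,D}(X)$ be the image of $K_{\mathcal E,D}(X)$ in $\mathbb R^{\mathcal E}/L_{\mathcal E}$. A specialization $(\mathcal E_1,D_1)\to(\mathcal E_2,D_2)$ induces a face inclusion $K_{\mathcal E_2,D_2}(X)\to K_{\mathcal E_1,D_1}(X)$ keeping the coordinates $x_e$, $e\in\mathcal E_2$, and setting, for $e\in\mathcal E_1\setminus\mathcal E_2$, $x_e=0$ if $e^s$ is contracted and $x_e=\ell(e)$ if $e^t$ is contracted; this induces an injective affine map $P_{\mathcal E_2,D_2}(X)\to P_{\mathcal E_1,D_1}(X)$. Complexes. $P_\mu^{\mathrm{trop}}(X)=\varinjlim P_{\mathcal E,D}(X)$ over all $\mu$-polystable pseudo-divisors on the $\mu$-model and all specializations between them. $J^{\mathrm{trop}}_{p_0,\mu}(X)=\varinjlim K_{\mathcal E,D}(X)$ over all $(p_0,\mu)$-quasistable pseudo-divisors on the model obtained from the $\mu$-model by adding $p_0$ as a vertex (if it is not one already) and all specializations between them. Colimits are taken in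 topological spaces. A refinement map of polyhedral complexes is a homeomorphism of the underlying topological spaces mapping each polyhedron of the source, via an injective affine map, into a polyhedron of the target. *)

(* Defs.v *)
From HB Require Import structures.
From mathcomp Require Import all_boot all_order all_algebra.
From mathcomp Require Import generic_quotient ring lra.
From mathcomp Require Import all_classical all_reals all_analysis.
From Stdlib Require Import Relation_Operators.

Set Implicit Arguments.
Unset Strict Implicit.
Unset Printing Implicit Defensive.

Import Order.TTheory GRing.Theory Num.Theory.
Import numFieldNormedType.Exports.

Local Open Scope classical_set_scope.
Local Open Scope ring_scope.

(** * Oriented finite multigraphs *)

Record graph := Graph {
  gV : finType;
  gE : finType;
  gsrc : gE -> gV;
  gtgt : gE -> gV }.

Definition adjacent (G : graph) : rel (gV G) := fun u v =>
  [exists e, (gsrc e == u) && (gtgt e == v) || (gsrc e == v) && (gtgt e == u)].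

Definition connected_graph (G : graph) : Prop :=
  (exists v : gV G, True) /\ forall u v : gV G, connect (@adjacent G) u v.

(** [E(V, V^c)] *)
Definition cut_edges (G : graph) (V : {set gV G}) : {set gE G} :=
  [set e | (gsrc e \in V) != (gtgt e \in V)].

Definition delta (G : graph) (V : {set gV G}) : nat := #|cut_edges V|.

Definition val_in (G : graph) (E : {set gE G}) (v : gV G) : nat :=
  (\sum_(e in E) ((gsrc e == v) + (gtgt e == v)))%N.

(** [Gamma_E] *)
Definition del_edges (G : graph) (E : {set gE G}) : graph :=
  @Graph (gV G) {e : gE G | e \notin E}
    (fun e => gsrc (val e)) (fun e => gtgt (val e)).

(** [Gamma^E]: the exceptional vertex [v_e] is [inr e]; over [e] in [E] the edge
    [e^s] is [inr (e, false)], from [s(e)] to [v_e], and [e^t] is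
    [inr (e, true)], from [v_e] to [t(e)]. *)
Definition subdiv (G : graph) (E : {set gE G}) : graph :=
  @Graph (gV G + {e : gE G | e \in E})%type
         ({e : gE G | e \notin E} + {e : gE G | e \in E} * bool)%type
    (fun e => match e with
              | inl e => inl (gsrc (val e))
              | inr (e, false) => inl (gsrc (val e))
              | inr (e, true) => inr e
              end)
    (fun e => match e with
              | inl e => inl (gtgt (val e))
              | inr (e, false) => inr e
              | inr (e, true) => inl (gtgt (val e))
              end).

(** * Pseudo-divisors and stability *)

Definition pseudo_divisor (G : graph) : choiceType :=
  {D : {E : {set gE G} & {ffun gV (subdiv E) -> int}}
     | [forall e : {e : gE G | e \in tag D}, tagged D (inr e) == -1]}.

Definition pd_edges (G : graph) (D : pseudo_divisor G) : {set gE G} :=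
  tag (val D).

Definition pd_val (G : graph) (D : pseudo_divisor G) :
  gV (subdiv (pd_edges D)) -> int := fun v => tagged (val D) v.

Arguments pd_val {G} D v.

Definition pd_degree (G : graph) (D : pseudo_divisor G) : int :=
  \sum_v pd_val D v.

Section Stability.
Context {R : realType} {G : graph}.
Variable mu : gV G -> R.
Implicit Types (D : pseudo_divisor G) (V : {set gV G}).

Definition beta D V : R :=
  \sum_(v in V) (pd_val D (inl v))%:~R
  - \sum_(v in V) (mu v + (val_in (pd_edges D) v)%:R / 2)
  + (delta (V : {set gV (del_edges (pd_edges D))}))%:R / 2.

Definition polystable D : Prop := forall V,
  0 <= beta D V /\ (~~ (cut_edges V \subset pd_edges D) -> 0 < beta D V).

Definition quasistable (v0 : gV G) D : Prop := forall V, V \proper [set: gV G]%SET ->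
  0 <= beta D V /\ (v0 \in V -> 0 < beta D V).

End Stability.

(** The choice made at [e] is [c e], with [false] for [e^s] and [true] for
    [e^t]; only the values of [c] on [E1 :\: E2] matter. Each exceptional vertex
    meets at most one chosen edge, so contracting the chosen edges merges every
    [v_e], [e] in [E1 :\: E2], into the chosen end of [e] and makes no other
    identification. *)
Definition contract (G : graph) (E1 E2 : {set gE G}) (c : gE G -> bool)
    (w : gV (subdiv E1)) : gV (subdiv E2) :=
  match w with
  | inl v => inl v
  | inr e => if insub (val e) is Some e' then inr e'
             else inl (if c (val e) then gtgt (val e) else gsrc (val e))
  end.

Arguments contract {G E1} E2 c w.

Definition specialization (G : graph) (D1 D2 : pseudo_divisor G)
    (c : gE G -> bool) : Prop :=
  pd_edges D2 \subset pd_edges D1 /\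
  forall u : gV (subdiv (pd_edges D2)),
    pd_val D2 u = \sum_(w | contract (pd_edges D2) c w == u) pd_val D1 w.

(** * Polyhedral complexes *)

(** A diagram of subsets of [R^n]. [pc_glue i j x y] says that one of the arrows
    from [i] to [j] maps the point [x] of the cell [i] to the point [y] of the
    cell [j]. *)
Record polyhedral_complex (R : realType) := PolyhedralComplex {
  pc_dim : nat;
  pc_idx : choiceType;
  pc_cell : pc_idx -> set 'rV[R]_pc_dim;
  pc_glue : pc_idx -> pc_idx -> 'rV[R]_pc_dim -> 'rV[R]_pc_dim -> Prop }.

Section Colimit.
Context {R : realType} (C : polyhedral_complex R).

Definition pc_disjoint : topologicalType := {i : pc_idx C & pc_cell i}.

Definition pc_step (a b : pc_disjoint) : Prop :=
  pc_glue (tag a) (tag b) (\val (tagged a)) (\val (tagged b)).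

Definition pc_rel (a b : pc_disjoint) : bool :=
  `[< clos_refl_sym_trans _ pc_step a b >].

Fact pc_rel_refl : reflexive pc_rel.
Proof. by move=> a; apply/asboolP; exact: rst_refl. Qed.

Fact pc_rel_sym : symmetric pc_rel.
Proof. by move=> a b; apply/asboolP/asboolP; exact: rst_sym. Qed.

Fact pc_rel_trans : transitive pc_rel.
Proof.
by move=> b a c /asboolP ab /asboolP bc; apply/asboolP; exact: rst_trans ab bc.
Qed.

Canonical pc_equiv := EquivRel pc_rel pc_rel_refl pc_rel_sym pc_rel_trans.

Definition pc_space : topologicalType := quotient_topology {eq_quot pc_equiv}%qT.

Definition pc_in (i : pc_idx C) (x : pc_cell i) : pc_space :=
  (\pi_(pc_space) (existT _ i x : pc_disjoint))%qT.

End Colimit.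

Definition homeomorphism (S T : topologicalType) (f : S -> T) : Prop :=
  continuous f /\ exists g : T -> S, [/\ cancel f g, cancel g f & continuous g].

Definition refinement_map (R : realType) (C C' : polyhedral_complex R)
    (f : pc_space C -> pc_space C') : Prop :=
  homeomorphism f /\
  forall i : pc_idx C, exists j : pc_idx C',
  exists (A : 'M[R]_(pc_dim C, pc_dim C')) (b : 'rV[R]_(pc_dim C')),
    {in pc_cell i &, injective (fun x => x *m A + b)} /\
    forall x : pc_cell i, exists y : pc_cell j,
      \val y = \val x *m A + b /\ f (pc_in x) = pc_in y.

(** * The polytopes *)

Section Polytopes.
Context {R : realType} {G : graph}.
Variable len : gE G -> R.
Implicit Types (E : {set gE G}) (c : gE G -> bool).

(** [R^E] is the subspace of [R^(gE G)] of the vectors vanishing outside [E]. *)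
Definition coord (x : 'rV[R]_#|gE G|) (e : gE G) : R := x 0 (enum_rank e).

Definition vec (f : gE G -> R) : 'rV[R]_#|gE G| := \row_i f (enum_val i).

Definition u_ (e : gE G) : 'rV[R]_#|gE G| := delta_mx 0 (enum_rank e).

Definition cell_K E : set 'rV[R]_#|gE G| :=
  [set x | forall e, (e \in E -> 0 <= coord x e <= len e) /\
                     (e \notin E -> coord x e = 0)].

Definition u_cut E (V : {set gV G}) : 'rV[R]_#|gE G| :=
  \sum_(e in E | (gsrc e \in V) && (gtgt e \notin V)) u_ e
  - \sum_(e in E | (gtgt e \in V) && (gsrc e \notin V)) u_ e.

(** [L_E], as a row space *)
Definition L_ E : 'M[R]_#|gE G| :=
  (\sum_(V : {set gV G} | cut_edges V \subset E) <<u_cut E V>>)%MS.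

(** [R^(gE G) / L_E] is realized as the image of [cokermx (L_ E)], the linear
    map [x |-> x *m cokermx (L_ E)] having kernel [L_E]. *)
Definition proj_L E (x : 'rV[R]_#|gE G|) : 'rV[R]_#|gE G| := x *m cokermx (L_ E).

Definition cell_P E : set 'rV[R]_#|gE G| := proj_L E @` cell_K E.

Definition face_map (E1 E2 : {set gE G}) c (x : 'rV[R]_#|gE G|) :
    'rV[R]_#|gE G| :=
  vec (fun e => if e \in E2 then coord x e
                else if e \in E1 then (if c e then len e else 0) else 0).

Definition J_complex (d : int) (mu : gV G -> R) (v0 : gV G) :
    polyhedral_complex R :=
  @PolyhedralComplex R #|gE G|
    {D : pseudo_divisor G | `[< pd_degree D = d /\ quasistable mu v0 D >]}
    (fun D => cell_K (pd_edges (val D)))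
    (fun D2 D1 x y => exists2 c, specialization (val D1) (val D2) c &
       y = face_map (pd_edges (val D1)) (pd_edges (val D2)) c x).

Definition P_complex (d : int) (mu : gV G -> R) : polyhedral_complex R :=
  @PolyhedralComplex R #|gE G|
    {D : pseudo_divisor G | `[< pd_degree D = d /\ polystable mu D >]}
    (fun D => cell_P (pd_edges (val D)))
    (fun D2 D1 x y => exists2 c, specialization (val D1) (val D2) c &
       exists2 z, cell_K (pd_edges (val D2)) z &
         x = proj_L (pd_edges (val D2)) z /\
         y = proj_L (pd_edges (val D1))
               (face_map (pd_edges (val D1)) (pd_edges (val D2)) c z)).

End Polytopes.

(** * Tropical curves *)

Section Gluing.
Context {R : realType} {X : metricType R} {G : graph}.
Variables (len : gE G -> R) (vx : gV G -> X) (ed : gE G -> R -> X).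

Definition on_segment (p q : X) (l : R) : Prop := exists e x y,
  [/\ 0 <= x <= len e, 0 <= y <= len e, p = ed e x, q = ed e y & l = `|x - y|].

Inductive walk : X -> X -> R -> Prop :=
| walk_nil p : walk p p 0
| walk_cons p q r l l' : on_segment p q l -> walk q r l' -> walk p r (l + l').

(** [X] is obtained by gluing segments [ [0, len e] ] along [G], with the
    quotient metric: [ed e] parametrizes the segment of [e] from [gsrc e] to
    [gtgt e], its values outside [ [0, len e] ] being irrelevant. *)
Record gluing : Prop := Gluing {
  len_gt0 : forall e, 0 < len e;
  ed_src : forall e, ed e 0 = vx (gsrc e);
  ed_tgt : forall e, ed e (len e) = vx (gtgt e);
  vx_inj : injective vx;
  ed_inj : forall e e' x x', 0 < x < len e -> 0 < x' < len e' ->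
    ed e x = ed e' x' -> e = e' /\ x = x';
  ed_vx : forall e x v, 0 < x < len e -> ed e x <> vx v;
  ed_surj : forall p, (exists v, p = vx v) \/
    (exists e x, 0 < x < len e /\ p = ed e x);
  mdist_walk : forall p q, mdist p q = inf [set l | walk p q l] }.

End Gluing.

Record model (R : realType) (X : metricType R) := Model {
  mgraph :> graph;
  mconn : connected_graph mgraph;
  mlen : gE mgraph -> R;
  mvx : gV mgraph -> X;
  med : gE mgraph -> R -> X;
  mglue : gluing mlen mvx med }.

(** Adding the point [med e0 x0], [0 < x0 < mlen e0], as a vertex; it becomes the
    exceptional vertex of [subdiv [set e0]]. *)
Section SplitModel.
Context {R : realType} {X : metricType R} (M : model X).
Variables (e0 : gE M) (x0 : R).
Hypothesis hx0 : 0 < x0 < mlen e0.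

Local Notation H := (subdiv [set e0]%SET).

Definition split_len (e : gE H) : R :=
  match e with
  | inl e => mlen (val e)
  | inr (_, false) => x0
  | inr (_, true) => mlen e0 - x0
  end.

Definition split_vx (v : gV H) : X :=
  match v with inl v => mvx v | inr _ => med e0 x0 end.

Definition split_ed (e : gE H) (y : R) : X :=
  match e with
  | inl e => med (val e) y
  | inr (_, false) => med e0 y
  | inr (_, true) => med e0 (x0 + y)
  end.

Let e0' : {e | e \in [set e0]%SET} := Sub e0 (set11 e0).

Let e0'E (e : {e | e \in [set e0]%SET}) : e = e0'.
Proof. by apply: val_inj; case: e => e /=; rewrite inE => /eqP. Qed.

Lemma split_conn : connected_graph H.
Proof.
have [[v _] con] := mconn M.
have adjC u w : @adjacent H u w = @adjacent H w u.
  by apply/existsP/existsP => -[e he]; exists e; rewrite orbC.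
have symc : connect_sym (@adjacent H) by exact: sym_connect_sym.
have cs : connect (@adjacent H) (inl (gsrc e0)) (inr e0').
  by apply: connect1; apply/existsP; exists (inr (e0', false)); rewrite /= !eqxx.
have ct : connect (@adjacent H) (inr e0') (inl (gtgt e0)).
  by apply: connect1; apply/existsP; exists (inr (e0', true)); rewrite /= !eqxx.
have cst := connect_trans cs ct.
have step u w : @adjacent M u w -> connect (@adjacent H) (inl u) (inl w).
  move=> /existsP[e he].
  have [ee0|ne] := eqVneq e e0.
    move: he; rewrite ee0 => /orP[]/andP[/eqP<- /eqP<-]; first exact: cst.
    by rewrite symc.
  have ne' : e \notin [set e0]%SET by rewrite inE.
  by apply: connect1; apply/existsP; exists (inl (Sub e ne')).
have conl u w : connect (@adjacent H) (inl u) (inl w).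
  have /connectP[p hp ->] := con u w.
  elim: p u hp => [//|a p ih] u /= /andP[ua /ih]; exact/connect_trans/step.
split; first by exists (inl v).
have conx x : connect (@adjacent H) (inl v) x.
  case: x => [w|e]; first exact: conl.
  by rewrite (e0'E e); apply: connect_trans (conl v (gsrc e0)) cs.
move=> x y; apply: connect_trans (conx y); by rewrite symc.
Qed.

Local Notation mseg := (on_segment (@mlen _ _ M) (@med _ _ M)).
Local Notation hseg := (on_segment split_len split_ed).
Local Notation mwalk := (walk (@mlen _ _ M) (@med _ _ M)).
Local Notation hwalk := (walk split_len split_ed).

Lemma split_seg p q l : hseg p q l -> mseg p q l.
Proof.
have /andP[x0_gt0 x0_lt] := hx0.
move=> -[[e|[e []]]] [x [y [/= /andP[hx hx'] /andP[hy hy'] -> -> ->]]].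
- by exists (val e), x, y; split; rewrite ?hx ?hy.
- exists e0, (x0 + x), (x0 + y); split => //; last by congr `|_|; ring.
    by apply/andP; split; lra.
  by apply/andP; split; lra.
- by exists e0, x, y; split => //; apply/andP; split; lra.
Qed.

Lemma hwalk_cat p q r l l' : hwalk p q l -> hwalk q r l' -> hwalk p r (l + l').
Proof.
elim=> [s|s t u a b hs _ ih] w; first by rewrite add0r.
by rewrite -addrA; exact: walk_cons hs (ih w).
Qed.

Lemma hseg_walk p q l : hseg p q l -> hwalk p q l.
Proof. by move=> h; rewrite -[l]addr0; exact: walk_cons h (walk_nil _ _ _). Qed.

Lemma hseg_lo x y : 0 <= x <= x0 -> 0 <= y <= x0 ->
  hwalk (med e0 x) (med e0 y) `|x - y|.
Proof. by move=> hx hy; apply: hseg_walk; exists (inr (e0', false)), x, y. Qed.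

Lemma hseg_hi x y : x0 <= x <= mlen e0 -> x0 <= y <= mlen e0 ->
  hwalk (med e0 x) (med e0 y) `|x - y|.
Proof.
move=> /andP[hx hx'] /andP[hy hy']; apply: hseg_walk.
exists (inr (e0', true)), (x - x0), (y - x0); split => /=.
- by apply/andP; split; lra.
- by apply/andP; split; lra.
- by congr med; ring.
- by congr med; ring.
- by congr `|_|; ring.
Qed.

Lemma seg_split p q l : mseg p q l -> hwalk p q l.
Proof.
have /andP[x0_gt0 x0_lt] := hx0.
move=> [e [x [y [hx hy -> -> ->]]]].
have [ee0|ne] := eqVneq e e0; last first.
  have ne' : e \notin [set e0]%SET by rewrite inE.
  by apply: hseg_walk; exists (inl (Sub e ne')), x, y.
subst e; move/andP: hx => [hx hx']; move/andP: hy => [hy hy'].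
have [xlt|xgt] := leP x x0; have [ylt|ygt] := leP y x0.
- by apply: hseg_lo; rewrite ?hx ?hy.
- have -> : `|x - y| = `|x - x0| + `|x0 - y|.
    by rewrite !ler0_norm; [ring|lra..].
  by apply: hwalk_cat (hseg_lo _ _) (hseg_hi _ _); apply/andP; split; lra.
- have -> : `|x - y| = `|x - x0| + `|x0 - y|.
    by rewrite !ger0_norm; [ring|lra..].
  by apply: hwalk_cat (hseg_hi _ _) (hseg_lo _ _); apply/andP; split; lra.
- by apply: hseg_hi; rewrite ?hx' ?hy' ?ltW.
Qed.

Lemma split_glue : gluing split_len split_vx split_ed.
Proof.
have /andP[x0_gt0 x0_lt] := hx0.
have [lgt0 eds edt vinj einj edvx surj dist] := mglue M.
have ve (e : {e | e \in [set e0]%SET}) : val e = e0 by rewrite (e0'E e).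
split.
- by move=> [e|[e []]] /=; rewrite ?subr_gt0.
- by move=> [e|[e []]] /=; rewrite ?addr0 // eds ve.
- by move=> [e|[e []]] //=; rewrite addrC subrK edt ve.
- move=> [v|e] [w|e'] /=.
  + by move=> /vinj ->.
  + by move=> /esym/edvx []; rewrite x0_gt0.
  + by move=> /edvx []; rewrite x0_gt0.
  + by rewrite (e0'E e) (e0'E e').
- have nl (e : {e | e \notin [set e0]%SET}) : val e <> e0.
    by case: e => e /=; rewrite inE => /eqP.
  move=> [e|[e b]] [e'|[e' b']] x x' /=.
  + by move=> hx hx' /einj -/(_ hx hx')[/val_inj -> ->].
  + case: b' => /andP[hx1 hx2] /andP[hy1 hy2] /einj [].
    * by rewrite hx1.
    * by apply/andP; split; lra.
    * by move/nl.
    * by rewrite hx1.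
    * by apply/andP; split; lra.
    * by move/nl.
  + case: b => /andP[hx1 hx2] /andP[hy1 hy2] /einj [].
    * by apply/andP; split; lra.
    * by rewrite hy1.
    * by move/esym/nl.
    * by apply/andP; split; lra.
    * by rewrite hy1.
    * by move/esym/nl.
  + rewrite (e0'E e) (e0'E e').
    by case: b; case: b' => /andP[hx1 hx2] /andP[hy1 hy2] /einj [||_ hxx];
      try (by apply/andP; split; lra); (try by exfalso; lra);
      split => //; lra.
- move=> [e|[e b]] x [v|e'] /=.
  + exact: edvx.
  + move=> hx /einj -/(_ hx hx0)[].
    by case: e hx => e /=; rewrite inE => /eqP.
  + by case: b => /andP[hx1 hx2]; apply: edvx; apply/andP; split; lra.
  + case: b => /andP[hx1 hx2] /einj -/(_ _ hx0)[|_ hxx];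
      try (by apply/andP; split; lra); lra.
- move=> p; have [[v ->]|[e [x [hx ->]]]] := surj p; first by left; exists (inl v).
  have [ee0|ne] := eqVneq e e0; last first.
    have ne' : e \notin [set e0]%SET by rewrite inE.
    by right; exists (inl (Sub e ne')), x.
  subst e; move/andP: hx => [hx hx'].
  have [xlt|xgt|->] := ltgtP x x0.
  + by right; exists (inr (e0', false)), x; rewrite /= hx.
  + right; exists (inr (e0', true)), (x - x0); split => /=.
      by apply/andP; split; lra.
    by congr med; ring.
  + by left; exists (inr e0').
- move=> p q; rewrite dist; congr inf; apply/seteqP; split => l /=.
    elim=> [r|r s t a b hs _ ih]; first exact: walk_nil.
    exact: hwalk_cat (seg_split hs) ih.
  elim=> [r|r s t a b hs _ ih]; first exact: walk_nil.
  exact: walk_cons (split_seg hs) ih.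
Qed.

Definition split_model : model X := Model split_conn split_glue.

End SplitModel.

(** [add_vertex M p0 M' v0]: [M'] is obtained from [M] by adding [p0] as a vertex
    if it is not one already, and [v0] is the vertex of [M'] at [p0]. *)
Inductive add_vertex (R : realType) (X : metricType R) (M : model X) :
    X -> forall M' : model X, gV M' -> Prop :=
| add_old (v : gV M) : @add_vertex R X M (mvx v) M v
| add_new (e : gE M) (x : R) (hx : 0 < x < mlen e) (v : gV (split_model hx)) :
    mvx v = med e x -> @add_vertex R X M (med e x) (split_model hx) v.

(** The space with the choice of a weighted model; the segments being glued along
    a connected graph, the space is connected. *)
Record tropical_curve (R : realType) := TropicalCurve {
  tc_space :> metricType R;
  tc_model : model tc_space;
  tc_wt : gV tc_model -> nat }.

Section TropicalCurve.
Context {R : realType} (X : tropical_curve R).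
Local Notation M := (tc_model X).

Definition tc_weight (p : X) : nat := (\sum_(v | mvx v == p) tc_wt v)%N.

(** The number of segment ends at [p], plus two if [p] lies inside a segment. *)
Definition tc_valence (p : X) : nat :=
  (\sum_(e : gE M) ((med e 0%R == p) + (med e (mlen e) == p)
     + 2 * `[< exists x : R, (0 < x < mlen e)%R /\ med e x = p >]))%N.

Definition polarization (d : int) (mu : X -> R) : Prop :=
  finite_set [set p | mu p != 0] /\ \sum_(p \in [set: X]) mu p = d%:~R.

Definition mu_vertices (mu : X -> R) : set X :=
  [set p | tc_valence p <> 2 \/ tc_weight p <> 0%N \/ mu p <> 0].

Definition mu_model (mu : X -> R) (G : model X) : Prop :=
  range (@mvx R X G) = mu_vertices mu.

Definition mu_at (mu : X -> R) (G : model X) (v : gV G) : R := mu (mvx v).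

Definition P_trop (d : int) (mu : X -> R) (G : model X) : polyhedral_complex R :=
  P_complex (@mlen R X G) d (@mu_at mu G).

Definition J_trop (d : int) (mu : X -> R) (G : model X) (v0 : gV G) :
    polyhedral_complex R :=
  J_complex (@mlen R X G) d (@mu_at mu G) v0.

End TropicalCurve.

(* Main.v *)
(** Sliding every exceptional chip to the source of its edge turns a point of
    either complex into an integral divisor on the vertices together with a
    vector of coordinates; linear equivalence then reads
    [a1 - a2 = boundary c] and [c_e l_e + x2_e - x1_e = phi(t e) - phi(s e)] for
    an integral flow [c] and a potential [phi].  Both spaces are identified with
    the set of linear equivalence classes.  Cutting along the sublevel sets of
    [phi] and adding the two stability inequalities shows that all slopes are at
    most 1 and that both stability functions vanish on these cuts.  So [phi] is
    constant for quasistable points, and for polystable points its differential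
    lies in the space divided out, after which the two points have a common
    polystable face.  A quasistable pseudo-divisor is completed to a polystable
    one by adding the cuts on which the stability function vanishes; conversely
    each fibre of a polystable cube over its polytope contains a quasistable
    point, found by pushing the chips away from the base point as far as
    possible.  Hence every polytope is covered by images of finitely many compact
    faces, which gives continuity of the inverse. *)

Require Import Defs.
From mathcomp Require Import all_boot all_order all_algebra.
From mathcomp Require Import generic_quotient zify ring lra.
From mathcomp Require Import all_classical all_reals all_analysis.
From Stdlib Require Import Relation_Operators.

Set Implicit Arguments.
Unset Strict Implicit.
Unset Printing Implicit Defensive.

Import Order.TTheory GRing.Theory Num.Theory.
Import numFieldNormedType.Exports.

Local Open Scope classical_set_scope.
Local Open Scope ring_scope.

Local Notation coord := Defs.coord.

(** * Gluing homeomorphisms of polyhedral complexes *)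

Lemma mx_continuous (T : topologicalType) (R : numFieldType) m n
    (f : T -> 'M[R]_(m, n)) :
  (forall i j, continuous (fun t => f t i j)) -> continuous f.
Proof.
move=> cf t A [P PM PA]; rewrite nbhs_simpl /=.
have : \forall x \near t, forall i j, P i j (f x i j).
  apply: filter_forall => i; apply: filter_forall => j.
  exact: (cf i j t) (PM i j).
by apply: filterS => x Px; exact: PA.
Qed.

Lemma lincomb_continuous (T : topologicalType) (R : realType) (I : finType)
    (f : I -> T -> R) (a : I -> R) (b : R) :
  (forall i, continuous (f i)) ->
  continuous (fun t => \sum_i f i t * a i + b).
Proof.
move=> cf t; apply: cvgD; last exact: cvg_cst.
apply: cvg_big => [|i _]; first exact: add_continuous.
by apply: cvgM; [exact: cf|exact: cvg_cst].
Qed.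

Lemma affine_continuous (R : realType) m n (A : 'M[R]_(m, n)) (b : 'rV[R]_n) :
  continuous (fun x : 'rV[R]_m => x *m A + b).
Proof.
apply: mx_continuous => i j; rewrite (ord1 i).
rewrite (_ : (fun x => _) =
    (fun x : 'rV[R]_m => \sum_k x 0 k * A k j + b 0 j)); last first.
  by apply/funext => x; rewrite !mxE.
by apply: lincomb_continuous => k; exact: coord_continuous.
Qed.


Lemma pc_inP (R : realType) (D : polyhedral_complex R) (a b : pc_disjoint D) :
  pc_in (projT2 a) = pc_in (projT2 b) <->
  clos_refl_sym_trans _ (@pc_step _ D) a b.
Proof.
rewrite /pc_in; case: a b => [i x] [j y] /=; split.
  by move=> /(@eqquotP _ (pc_equiv D) {eq_quot pc_equiv D}%qT) /asboolP.
by move=> h; apply/(@eqquotP _ (pc_equiv D) {eq_quot pc_equiv D}%qT)/asboolP.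
Qed.

Lemma pc_in_continuous (R : realType) (D : polyhedral_complex R)
  (i : pc_idx D) : continuous (@pc_in _ D i).
Proof.
move=> x; apply: (@continuous_comp _ _ _ (existT _ i)).
  exact: existT_continuous.
exact: pi_continuous.
Qed.

Section Refinement.
Context {R : realType} {C C' : polyhedral_complex R}.
Variable S : pc_disjoint C -> pc_disjoint C' -> Prop.
Hypothesis S_rel : forall a a' b b', S a a' -> S b b' ->
  (clos_refl_sym_trans _ (@pc_step _ C) a b <->
   clos_refl_sym_trans _ (@pc_step _ C') a' b').
Hypothesis compact_cell : forall i, compact (@pc_cell _ C i).
Hypothesis S_affine : forall i : pc_idx C, exists j : pc_idx C',
  exists (A : 'M[R]_(pc_dim C, pc_dim C')) (b : 'rV[R]_(pc_dim C')),
    {in pc_cell i &, injective (fun x => x *m A + b)} /\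
    forall x : pc_cell i, exists y : pc_cell j,
      \val y = \val x *m A + b /\ S (existT _ i x) (existT _ j y).
Hypothesis S_cover : forall j : pc_idx C', exists (I : finType)
  (k : I -> pc_idx C) (A : I -> 'M[R]_(pc_dim C, pc_dim C'))
  (b : I -> 'rV[R]_(pc_dim C')),
  (forall t (x : pc_cell (k t)), exists y : pc_cell j,
      \val y = \val x *m A t + b t /\ S (existT _ (k t) x) (existT _ j y)) /\
  forall y : pc_cell j, exists t (x : pc_cell (k t)),
      \val y = \val x *m A t + b t.

(** The cell is compact, so the part of it lying over a closed set is compact; its continuous image
    is again compact, hence closed. *)
Lemma cell_closed_image (i : pc_idx C) (F : set (pc_space C)) n
    (A : 'M[R]_(pc_dim C, n)) (b : 'rV[R]_n) : closed F ->
  closed [set \val x *m A + b | x in [set x : pc_cell i | F (pc_in x)]].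
Proof.
move=> cF.
have cG : closed [set x : pc_cell i | F (pc_in x)].
  by have /continuous_closedP := @pc_in_continuous _ C i; exact.
(* A cell carries the subspace topology, so its closed subset is the trace of a closed set [W] of
   the ambient space; compactness is then argued there. *)
have [W cW WE] : exists2 W, closed W &
    forall x : pc_cell i, W (\val x) <-> F (pc_in x).
  have := closed_openC cG; rewrite /open /= => -[U oU UE].
  exists (~` U); first exact: open_closedC.
  move=> x; have := congr1 (fun B => B x) UE; rewrite /= => Ux.
  by split=> [nU|Fx]; [apply: contrapT; rewrite -Ux|rewrite Ux; apply].
apply: compact_closed => //.
rewrite (_ : [set _ | _ in _] = (fun x => x *m A + b) @` (pc_cell i `&` W)).
  apply: continuous_compact; last exact: compact_closedI.
  exact/continuous_subspaceT/affine_continuous.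
apply/seteqP; split=> [_ [x /WE Fx <-]|_ [x [ix Wx] <-]].
  by exists (\val x) => //; split => //; exact: set_valP.
by exists (SigSub (mem_set ix)) => //; exact/WE.
Qed.

(** Both [f] and [g] send a class to the class of an arbitrary [S]-partner of a representative;
    [S_rel] makes all choices irrelevant and the two maps mutually inverse. Continuity of [f] is
    checked cell by cell, where it is affine; that of [g] uses closed sets and the finite covers of
    [S_cover]. *)
Lemma refinement_criterion : exists f : pc_space C -> pc_space C',
  refinement_map f.
Proof.
have S_total a : exists a', S a a'.
  case: a => i x; have [j [A [b [_ /(_ x) [y [_ Sxy]]]]]] := S_affine i.
  by exists (existT _ j y).
have S_surj a' : exists a, S a a'.
  case: a' => j y; have [I [k [A [b [hS hy]]]]] := S_cover j.
  have [t [x yE]] := hy y; have [y' [y'E Sxy]] := hS t x.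
  exists (existT _ (k t) x); congr (S _ (existT _ j _)): Sxy.
  by apply: val_inj; rewrite y'E yE.
pose F a := projT1 (cid (S_total a)).
have FS a : S a (F a) by rewrite /F; case: cid.
pose H a := projT1 (cid (S_surj a)).
have HS a : S (H a) a by rewrite /H; case: cid.
pose f (p : pc_space C) : pc_space C' := pc_in (projT2 (F (repr p))).
pose g (p : pc_space C') : pc_space C := pc_in (projT2 (H (repr p))).
have reprE (D : polyhedral_complex R) (p : pc_space D) :
    pc_in (projT2 (repr p)) = p.
  by rewrite /pc_in -[RHS]reprK; case: (repr p).
have fE a a' : S a a' -> f (pc_in (projT2 a)) = pc_in (projT2 a').
  move=> Sa; apply/pc_inP/(S_rel (FS _) Sa)/pc_inP; exact: reprE.
have gE a a' : S a a' -> g (pc_in (projT2 a')) = pc_in (projT2 a).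
  move=> Sa; apply/pc_inP/(S_rel (HS _) Sa)/pc_inP; exact: reprE.
have fK : cancel f g.
  by move=> p; rewrite -[p in LHS]reprE (fE _ _ (FS _)) (gE _ _ (FS _)) reprE.
have gK : cancel g f.
  by move=> p; rewrite -[p in LHS]reprE (gE _ _ (HS _)) (fE _ _ (HS _)) reprE.
exists f; split; last first.
  move=> i; have [j [A [b [injA hA]]]] := S_affine i; exists j, A, b; split => // x.
  by have [y [yE Sxy]] := hA x; exists y; split => //; exact: fE Sxy.
split; last exists g; last split => //.
  apply/quotient_continuous; rewrite (_ : f \o _ =
      unstable.sigT_fun (fun i (x : pc_cell i) => f (pc_in x))); last first.
    by apply/funext => -[i x].
  apply: sigT_continuous => i; have [j [A [b [_ hA]]]] := S_affine i.
  pose y x := projT1 (cid (hA x)).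
  have yP x : \val (y x) = \val x *m A + b /\ S (existT _ i x) (existT _ j (y x)).
    by rewrite /y; case: cid.
  rewrite (_ : (fun x => _) = @pc_in _ C' j \o y); last first.
    by apply/funext => x; have [_ /fE] := yP x.
  have cy : continuous y.
    apply/continuousP => _ [U oU <-].
    rewrite (_ : _ @^-1` _ = (fun x => \val x *m A + b) @^-1` U); last first.
      by apply/seteqP; split => x /=; rewrite -(yP x).1.
    have /continuousP : continuous ((fun x => x *m A + b) \o (\val : pc_cell i -> _)).
      move=> x; apply: continuous_comp; first exact: initial_continuous.
      exact: affine_continuous.
    exact.
  move=> x; apply: (@continuous_comp _ _ _ y (@pc_in _ C' j)); first exact: cy.
  exact: pc_in_continuous.
apply/quotient_continuous; rewrite (_ : g \o _ =
    unstable.sigT_fun (fun j (x : pc_cell j) => g (pc_in x))); last first.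
  by apply/funext => -[i x].
apply: sigT_continuous => j; apply/continuous_closedP => Z cZ.
(* On the cell [j] the preimage of [Z] is a finite union of affine images of closed parts of compact
   cells. *)
have [I [k [A [b [hS hy]]]]] := S_cover j.
rewrite (_ : _ @^-1` _ = (\val : pc_cell j -> _) @^-1`
  \bigcup_(t in [set: I])
    [set \val x *m A t + b t | x in [set x : pc_cell (k t) | Z (pc_in x)]]).
  have /continuous_closedP : continuous (\val : pc_cell j -> _).
    exact: initial_continuous.
  apply; apply: closed_bigcup => [|t _]; first exact: finite_finset.
  exact: cell_closed_image.
apply/seteqP; split => y /= => [Zy|[t _ [x Zx xE]]].
  have [t [x yE]] := hy y; have [y' [y'E Sxy]] := hS t x.
  exists t => //; exists x => //=.
  have y'y : y' = y by apply: val_inj; rewrite y'E yE.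
  by rewrite y'y in Sxy; rewrite -(gE _ _ Sxy).
have [y' [y'E Sxy]] := hS t x.
have y'y : y' = y by apply: val_inj; rewrite y'E xE.
by rewrite y'y in Sxy; rewrite (gE _ _ Sxy).
Qed.

End Refinement.

(** * Pseudo-divisors as divisors on the vertices *)

Section PseudoDivisors.
Context {R : realType} {G : graph}.
Implicit Types (E : {set gE G}) (a : gV G -> int) (V : {set gV G}).

Definition boundary (c : gE G -> int) (v : gV G) : int :=
  \sum_e c e * ((gtgt e == v)%:R - (gsrc e == v)%:R).

Definition srcs E (v : gV G) : int := \sum_(e in E) (gsrc e == v)%:R.

(** A pseudo-divisor is encoded by its set [E] of edges and the divisor [base]
    on [gV G] obtained by sliding each exceptional chip to the source of its
    edge; the coordinates [x_e] record how far it was slid. *)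
Definition base (D : pseudo_divisor G) (v : gV G) : int :=
  pd_val D (inl v) - srcs (pd_edges D) v.

Lemma pd_val_inr (D : pseudo_divisor G) e : pd_val D (inr e) = -1.
Proof. exact/eqP/(forallP (valP D) e). Qed.

Definition pd_fun E a : {ffun gV (subdiv E) -> int} :=
  [ffun u => if u is inl v then a v + srcs E v else -1].

Fact mk_pd_subproof E a :
  [forall e : {e : gE G | e \in E}, pd_fun E a (inr e) == -1].
Proof. by apply/forallP => e; rewrite ffunE. Qed.

Definition mk_pd E a : pseudo_divisor G :=
  exist _ (existT (fun E => {ffun gV (subdiv E) -> int}) E (pd_fun E a))
    (mk_pd_subproof E a).

Lemma base_mk_pd E a v : base (mk_pd E a) v = a v.
Proof. by rewrite /base /pd_val /= ffunE addrK. Qed.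

Lemma sum_mem (T : finType) (A : {set T}) (F : T -> R) :
  \sum_(x in A) F x = \sum_x (x \in A)%:R * F x.
Proof.
rewrite big_mkcond; apply: eq_bigr => x _.
by case: (x \in A); rewrite ?mul1r ?mul0r.
Qed.

Lemma sum_mul_eq (S : nzRingType) (T : finType) (w : T -> S) (x : T) :
  \sum_v w v * (x == v)%:R = w x.
Proof.
rewrite (bigD1 x) //= eqxx mulr1 big1 ?addr0 // => v; rewrite eq_sym => /negbTE ->.
by rewrite mulr0.
Qed.

Lemma sum_bd (S : comNzRingType) (c : gE G -> int) (w : gV G -> S) :
  \sum_v w v * (boundary c v)%:~R = \sum_e (c e)%:~R * (w (gtgt e) - w (gsrc e)).
Proof.
under eq_bigr do rewrite /boundary rmorph_sum mulr_sumr.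
rewrite exchange_big; apply: eq_bigr => e _.
rewrite -(sum_mul_eq w (gtgt e)) -(sum_mul_eq w (gsrc e)) -sumrB mulr_sumr.
apply: eq_bigr => v _; rewrite rmorphM rmorphB /= !rmorph_nat; ring.
Qed.

Lemma sum_srcs (S : comNzRingType) E (w : gV G -> S) :
  \sum_v w v * (srcs E v)%:~R = \sum_(e in E) w (gsrc e).
Proof.
under eq_bigr do rewrite /srcs rmorph_sum mulr_sumr.
rewrite exchange_big; apply: eq_bigr => e _.
rewrite -(sum_mul_eq w (gsrc e)).
by apply: eq_bigr => v _; rewrite rmorph_nat.
Qed.

Lemma sum_sub (T : finType) (P : pred T) (S : nmodType) (F : T -> S) :
  \sum_(x : {x | P x}) F (val x) = \sum_(x | P x) F x.
Proof.
rewrite (reindex_omap (val : {x | P x} -> T) insub) => [|x Px]; last first.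
  by rewrite insubT.
apply: eq_bigl => x; rewrite valK (valP x) eqxx //.
Qed.

Lemma pd_degreeE (D : pseudo_divisor G) : pd_degree D = \sum_v base D v.
Proof.
rewrite /pd_degree big_sumType /=.
have -> : \sum_(e : {e | e \in pd_edges D}) pd_val D (inr e) =
    \sum_(e in pd_edges D) (-1 : int).
  rewrite -(sum_sub (mem (pd_edges D))); apply: eq_bigr => e _; exact: pd_val_inr.
rewrite /base sumrB sumrN; congr (_ - _).
have := sum_srcs (pd_edges D) (fun=> 1 : int).
by under eq_bigr do rewrite mul1r intz; move=> <-.
Qed.

(** The share of one edge in [beta]. For an edge of [E], the chip slid back to the source gives [s]
    and the valence correction takes away half of [s + t], leaving half of [s - t]; any other edge
    gives one half when it is cut. *)
Definition edge_term (b s t : bool) : R :=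
  (if b then s%:R - t%:R else (s (+) t)%:R) / 2.

Variable mu : gV G -> R.

Definition stab E a V : R :=
  \sum_v (v \in V)%:R * ((a v)%:~R - mu v)
  + \sum_e edge_term (e \in E) (gsrc e \in V) (gtgt e \in V).

Lemma betaE D V : beta mu D V = stab (pd_edges D) (base D) V.
Proof.
set E := pd_edges D.
have hval : \sum_(v in V) (val_in E v)%:R =
    \sum_(e in E) ((gsrc e \in V)%:R + (gtgt e \in V)%:R) :> R.
  rewrite sum_mem /val_in.
  under eq_bigr do rewrite natr_sum mulr_sumr.
  rewrite exchange_big; apply: eq_bigr => e _.
  under eq_bigr do rewrite natrD mulrDr.
  by rewrite big_split /= !sum_mul_eq.
have hdelta : (delta (V : {set gV (del_edges E)}))%:R =
    \sum_(e | e \notin E) ((gsrc e \in V) (+) (gtgt e \in V))%:R :> R.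
  rewrite /delta -sum1_card natr_sum big_mkcond /=.
  rewrite -(sum_sub [pred e | e \notin E]
     (fun e => ((gsrc e \in V) (+) (gtgt e \in V))%:R)) /=.
  apply: eq_bigr => e _; rewrite inE /=.
  by case: (_ \in V); case: (_ \in V).
rewrite /beta -/E hdelta big_split /= -mulr_suml hval /stab.
have -> : \sum_(v in V) (pd_val D (inl v))%:~R =
    \sum_v (v \in V)%:R * (base D v)%:~R + \sum_(e in E) (gsrc e \in V)%:R :> R.
  rewrite -(sum_srcs E (fun v => (v \in V)%:R)) -big_split /= sum_mem.
  apply: eq_bigr => v _.
  by rewrite -mulrDr -rmorphD /= /base subrK.
under [X in _ = X + _]eq_bigr do rewrite mulrBr.
rewrite sumrB -(sum_mem V mu).
rewrite (bigID (mem E) predT (fun e => edge_term _ _ _)) /=.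
have -> : \sum_(e in E) edge_term (e \in E) (gsrc e \in V) (gtgt e \in V) =
   \sum_(e in E) (gsrc e \in V)%:R
   - (\sum_(e in E) ((gsrc e \in V)%:R + (gtgt e \in V)%:R)) / 2.
  rewrite mulr_suml -sumrB; apply: eq_bigr => e ->; rewrite /edge_term; by field.
have -> : \sum_(e | e \notin E) edge_term (e \in E) (gsrc e \in V) (gtgt e \in V) =
   (\sum_(e | e \notin E) ((gsrc e \in V) (+) (gtgt e \in V))%:R) / 2.
  by rewrite mulr_suml; apply: eq_bigr => e /negbTE ->.
ring.
Qed.

(** Contracting [e^s] leaves the chip at the source, where the encoding already counts it;
    contracting [e^t] carries the value -1 from source to target, which subtracts a boundary. *)
Definition spec E1 a1 E2 a2 (c : gE G -> bool) : Prop :=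
  E2 \subset E1 /\ forall v, a2 v =
    a1 v - boundary (fun e => [&& e \in E1, e \notin E2 & c e]%:R) v.

Lemma specP D1 D2 c : specialization D1 D2 c <->
  spec (pd_edges D1) (base D1) (pd_edges D2) (base D2) c.
Proof.
set E1 := pd_edges D1; set E2 := pd_edges D2.
have key v : E2 \subset E1 ->
    \sum_(w | Defs.contract E2 c w == inl v) pd_val D1 w =
    base D1 v - boundary (fun e => [&& e \in E1, e \notin E2 & c e]%:R) v + srcs E2 v.
  move=> sE; rewrite big_sumType /=.
  have -> : \sum_(w : gV G | inl w == inl v :> gV (subdiv E2)) pd_val D1 (inl w) =
      pd_val D1 (inl v).
    by rewrite (big_pred1 v).
  have -> : \sum_(e : {e | e \in E1} | Defs.contract E2 c (inr e) == inl v)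
      pd_val D1 (inr e) =
      - \sum_(e in E1) ((e \notin E2) && ((if c e then gtgt e else gsrc e) == v))%:R.
    rewrite -(sum_sub (mem E1)
      (fun e => ((e \notin E2) && ((if c e then gtgt e else gsrc e) == v))%:R)).
    rewrite -sumrN big_mkcond /=; apply: eq_bigr => e _; rewrite pd_val_inr.
    have [h|h] := boolP (val e \in E2); last first.
      rewrite insubN //=; set u := if c _ then _ else _.
      by rewrite -[inl u == _]/(u == v); case: (u == v); rewrite ?oppr0.
    by rewrite insubT /= oppr0.
  rewrite /base -/E1; set p := pd_val _ _.
  rewrite -!addrA; congr (_ + _).
  rewrite /srcs /boundary (big_mkcond (mem E1)) (big_mkcond (mem E2)).
  rewrite (big_mkcond (mem E1) (fun e => (gsrc e == v)%:R)).
  rewrite -!sumrN -!big_split /=; apply: eq_bigr => e _.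
  move/fintype.subsetP: sE => /(_ e).
  case: (e \in E1); case: (e \in E2) => //= he; try by have := he isT.
  - by ring.
  - by case: (c e) => /=; ring.
  - by ring.
split=> [[sE h]|[sE h]]; split => // u.
  have := h (inl u); rewrite key // => hu.
  by rewrite {1}/base hu addrK.
case: u => [v|e]; first by rewrite key // -h /base subrK.
rewrite pd_val_inr.
have he : val e \in E1 by move/fintype.subsetP: sE; apply; exact: (valP e).
rewrite (big_pred1 (inr (Sub (val e) he) : gV (subdiv E1))) ?pd_val_inr //.
case=> [w|e'] //=; have [h'|h'] := boolP (val e' \in E2).
  by rewrite insubT /= (inj_eq (@inr_inj _ _)) (inj_eq (@inr_inj _ _)) -!val_eqE.
rewrite insubN //=.
by apply/esym/negbTE/eqP => -[e'E]; rewrite e'E (valP e) in h'.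
Qed.

End PseudoDivisors.

(** * Slicing along a potential *)

Section Slices.
Context {R : realType} {G : graph}.
Variables (mu : gV G -> R) (len : gE G -> R).
Hypothesis len_gt0 : forall e, 0 < len e.
Implicit Types (E : {set gE G}) (a : gV G -> int) (V : {set gV G})
  (x : gE G -> R) (c : gE G -> int) (phi : gV G -> R).

Local Notation stab := (stab mu).

Definition semistable E a : Prop := forall V, 0 <= stab E a V.

Definition pst E a : Prop := forall V,
  0 <= stab E a V /\ (~~ (cut_edges V \subset E) -> 0 < stab E a V).

Definition qst (v0 : gV G) E a : Prop := forall V,
  V \proper [set: gV G]%SET -> 0 <= stab E a V /\ (v0 \in V -> 0 < stab E a V).

Definition balanced a : Prop := \sum_v (a v)%:~R = \sum_v mu v.

Definition box E x : Prop := forall e,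
  (e \in E -> 0 <= x e <= len e) /\ (e \notin E -> x e = 0).

Lemma pst_semistable E a : pst E a -> semistable E a.
Proof. by move=> h V; have [] := h V. Qed.

Lemma bet_setT E a : balanced a -> stab E a [set: gV G]%SET = 0.
Proof.
move=> da; rewrite /stab [X in _ + X]big1 ?addr0 => [|e _].
  under eq_bigr do rewrite inE mul1r.
  by rewrite sumrB da subrr.
by rewrite !inE /edge_term; case: (e \in E); rewrite ?subrr mul0r.
Qed.

Lemma qst_semistable v0 E a : balanced a -> qst v0 E a -> semistable E a.
Proof.
move=> da h V; have [->|VT] := eqVneq V [set: gV G]%SET; first by rewrite bet_setT.
by have [] := h V; rewrite // properT.
Qed.

Lemma betC E a V : balanced a -> stab E a (~: V) =
  - \sum_v (v \in V)%:R * ((a v)%:~R - mu v)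
  + \sum_e edge_term (e \in E) (gsrc e \notin V) (gtgt e \notin V).
Proof.
move=> da; rewrite /stab; congr (_ + _); last first.
  by apply: eq_bigr => e _; rewrite !inE.
apply/eqP; rewrite -addr_eq0 -big_split /=.
under eq_bigr do rewrite -mulrDl inE.
rewrite (eq_bigr (fun v => (a v)%:~R - mu v)) => [|v _]; last first.
  by case: (v \in V); rewrite ?addr0 ?add0r mul1r.
by rewrite sumrB da subrr.
Qed.

(** The increment counts the removed edges that cross the cut and whose chip goes to the end outside
    [V]. It is never negative, so specializing can only raise the stability function. *)
Lemma spec_bet E1 a1 E2 a2 (c : gE G -> bool) V : spec E1 a1 E2 a2 c ->
  stab E2 a2 V = stab E1 a1 V + \sum_e [&& e \in E1, e \notin E2 &
     if c e then (gsrc e \in V) && (gtgt e \notin V)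
     else (gtgt e \in V) && (gsrc e \notin V)]%:R.
Proof.
move=> [sE aE]; rewrite /stab.
under eq_bigr do rewrite aE rmorphB /= addrAC mulrBr.
rewrite sumrB sum_bd -!addrA; congr (_ + _).
rewrite addrC -sumrB -big_split /=; apply: eq_bigr => e _.
move/fintype.subsetP: sE => /(_ e); rewrite /edge_term.
case: (e \in E1); case: (e \in E2) => h; try (by have := h isT);
  by case: (gsrc e \in V); case: (gtgt e \in V); case: (c e) => /=; field.
Qed.

Lemma spec_bet_le E1 a1 E2 a2 (c : gE G -> bool) V : spec E1 a1 E2 a2 c ->
  stab E1 a1 V <= stab E2 a2 V.
Proof.
by move=> h; rewrite (spec_bet V h) lerDl sumr_ge0 // => e _; exact: ler0n.
Qed.

Lemma spec_semistable E1 a1 E2 a2 (c : gE G -> bool) : spec E1 a1 E2 a2 c ->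
  semistable E1 a1 -> semistable E2 a2.
Proof. by move=> h s V; exact: le_trans (s V) (spec_bet_le V h). Qed.

(** When the increment is zero, no crossing edge sends its chip out of [V]: every removed one is
    contracted to its end in [V]. *)
Lemma spec_bet_eq E1 a1 E2 a2 (c : gE G -> bool) V e : spec E1 a1 E2 a2 c ->
  stab E2 a2 V = stab E1 a1 V -> e \in E1 -> e \notin E2 ->
  (gsrc e \in V) != (gtgt e \in V) -> c e = (gtgt e \in V).
Proof.
move=> h /eqP; rewrite (spec_bet V h) -subr_eq0 addrAC subrr add0r.
rewrite psumr_eq0 => [/allP /(_ e)|f _]; last exact: ler0n.
rewrite mem_index_enum pnatr_eq0 eqb0 => /(_ isT)/= + e1 e2.
rewrite e1 e2 /=.
by case: (gsrc e \in V); case: (gtgt e \in V); case: (c e).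
Qed.

Lemma spec_sum E1 a1 E2 a2 (c : gE G -> bool) : spec E1 a1 E2 a2 c ->
  \sum_v (a2 v)%:~R = \sum_v (a1 v)%:~R :> R.
Proof.
move=> [_ aE]; under eq_bigr do rewrite aE rmorphB /=.
rewrite sumrB; have := sum_bd (fun e => [&& e \in E1, e \notin E2 & c e]%:R)
   (fun=> 1 : R).
under eq_bigr do rewrite mul1r; move=> ->.
rewrite [X in _ - X]big1 ?subr0 // => e _; rewrite subrr; exact: mulr0.
Qed.

Lemma spec_balanced E1 a1 E2 a2 (c : gE G -> bool) : spec E1 a1 E2 a2 c ->
  balanced a1 -> balanced a2.
Proof. by rewrite /balanced => /spec_sum ->. Qed.

(** The divisors of the two points of the Jacobian differ by the divisor of the
    rational function with value [phi v] at [v] and with slope [c e] along [e]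
    away from the chips. *)
Definition lin_equiv_by c phi a1 x1 a2 x2 : Prop :=
  (forall v, a1 v - a2 v = boundary c v) /\
  (forall e, (c e)%:~R * len e + x2 e - x1 e = phi (gtgt e) - phi (gsrc e)).

(** If the potential rises across the level, then [k * l > - b2 * l], and integrality improves this
    to [k >= 1 - b2]; if it falls, [k <= b1 - 1] in the same way. The quantity [r] equals
    [1 - b2 - k] or [k + 1 - b1] in these cases, so it vanishes only at the extreme slope. *)
Lemma edge_slice (b1 b2 : bool) (k : int) (l y1 y2 p q tau : R) : 0 < l ->
  0 <= y1 -> y1 <= b1%:R * l -> 0 <= y2 -> y2 <= b2%:R * l ->
  k%:~R * l + y2 - y1 = q - p ->
  let r : R := k%:~R * ((q < tau)%R%:R - (p < tau)%R%:R)
           + edge_term b1 (p < tau) (q < tau)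
           + edge_term b2 (~~ (p < tau)) (~~ (q < tau)) in
  r <= 0 /\ (r = 0 -> (p < tau) != (q < tau) ->
             k = if q < tau then b1%:R - 1 else 1 - b2%:R).
Proof.
move=> l0 y1_ge y1_le y2_ge y2_le hk /=; rewrite /edge_term.
have [pt|pt] := ltP p tau; have [qt|qt] := ltP q tau => /=.
- by split => //; case: b1 {y1_le}; case: b2 {y2_le} => /=; lra.
- have hl : (0 - b2%:R)%:~R < k%:~R :> R.
    rewrite -(ltr_pM2r l0) rmorphB /= rmorph_nat rmorph0; lra.
  rewrite ltr_int in hl.
  have {}hl : (1 - b2%:R : int) <= k by move: hl; rewrite -lezD1; lra.
  have hlR : (1 - b2%:R) <= k%:~R :> R.
    have -> : 1 - b2%:R = (1 - b2%:R)%:~R :> R by rewrite rmorphB /= rmorph_nat.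
    by rewrite ler_int.
  split; first by case: b1 {y1_le}; case: b2 y2_le hl hlR => /=; lra.
  move=> hr _; apply: (@intr_inj R); rewrite rmorphB /= rmorph_nat.
  by move: hr; case: b1 {y1_le}; case: b2 {y2_le hl hlR} => /=; lra.
- have hl : k%:~R < b1%:R%:~R :> R.
    rewrite -(ltr_pM2r l0) rmorph_nat; lra.
  rewrite ltr_int in hl.
  have {}hl : k <= (b1%:R - 1 : int) by move: hl; rewrite -lezD1; lra.
  have hlR : k%:~R <= b1%:R - 1 :> R.
    have -> : b1%:R - 1 = (b1%:R - 1)%:~R :> R by rewrite rmorphB /= rmorph_nat.
    by rewrite ler_int.
  split; first by case: b2 {y2_le}; case: b1 y1_le hl hlR => /=; lra.
  move=> hr _; apply: (@intr_inj R); rewrite rmorphB /= rmorph_nat.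
  by move: hr; case: b2 {y2_le}; case: b1 {y1_le hl hlR} => /=; lra.
- by split => //; case: b1 {y1_le}; case: b2 {y2_le} => /=; lra.
Qed.

Lemma box_bounds E x e : box E x -> 0 <= x e /\ x e <= (e \in E)%:R * len e.
Proof.
move=> /(_ e); case: (e \in E) => -[h1 h2].
  by have /andP[] := h1 isT; rewrite mul1r.
by rewrite h2 // mul0r.
Qed.

Definition below phi (tau : R) : {set gV G} := [set v | phi v < tau]%SET.

Lemma slice E1 a1 x1 E2 a2 x2 c phi tau (V := below phi tau) :
  semistable E1 a1 -> semistable E2 a2 -> balanced a2 ->
  box E1 x1 -> box E2 x2 -> lin_equiv_by c phi a1 x1 a2 x2 ->
  [/\ stab E1 a1 V = 0, stab E2 a2 (~: V) = 0 &
    forall e, (gsrc e \in V) != (gtgt e \in V) ->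
      c e = if gtgt e \in V then (e \in E1)%:R - 1 else 1 - (e \in E2)%:R].
Proof.
move=> s1 s2 d2 h1 h2 [ca cx].
pose r e := (c e)%:~R * ((gtgt e \in V)%:R - (gsrc e \in V)%:R)
  + edge_term (e \in E1) (gsrc e \in V) (gtgt e \in V)
  + edge_term (e \in E2) (gsrc e \notin V) (gtgt e \notin V) : R.
have rE e : r e <= 0 /\ (r e = 0 -> (gsrc e \in V) != (gtgt e \in V) ->
      c e = if gtgt e \in V then (e \in E1)%:R - 1 else 1 - (e \in E2)%:R).
  rewrite /r !inE; have [? ?] := box_bounds e h1; have [? ?] := box_bounds e h2.
  exact: edge_slice (len_gt0 e) _ _ _ _ (cx e).
(* The terms in [mu] cancel between [V] and its complement, and summation by parts turns [a1 - a2],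
   the boundary of [c], into the slopes of [c] across the cut. *)
have sumE : stab E1 a1 V + stab E2 a2 (~: V) = \sum_e r e.
  rewrite betC // /stab !big_split /= -!addrA.
  rewrite -(sum_bd c (fun v => (v \in V)%:R)).
  rewrite [X in _ + X]addrCA addrA -sumrB; congr (_ + _).
  apply: eq_bigr => v _; rewrite -mulrBr -ca rmorphB /=; ring.
have r0 : \sum_e r e <= 0 by apply: sumr_le0 => e _; have [] := rE e.
have b1 := s1 V; have b2 := s2 (~: V)%SET.
have sr : \sum_e r e = 0 by apply/eqP; rewrite eq_le r0 -sumE addr_ge0.
split; [lra|lra|] => e; apply: (rE e).2; apply/eqP.
move/eqP: sr; rewrite -oppr_eq0 -sumrN psumr_eq0 => [/allP/(_ e)|f _].
  by rewrite mem_index_enum oppr_eq0 => /(_ isT).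
by rewrite oppr_ge0; have [] := rE f.
Qed.

(** Were [phi] not constant, the vertices below its maximum and their complement would both be
    proper subsets with vanishing stability. One of the two contains [v0], where quasistability asks
    for a strict inequality. *)
Lemma qst_unique v0 E1 a1 x1 E2 a2 x2 c phi :
  qst v0 E1 a1 -> qst v0 E2 a2 -> balanced a1 -> balanced a2 ->
  box E1 x1 -> box E2 x2 -> lin_equiv_by c phi a1 x1 a2 x2 ->
  forall u v, phi u = phi v.
Proof.
move=> q1 q2 d1 d2 h1 h2 hl.
pose m := [arg max_(m > v0) phi m]%O.
have hm v : phi v <= phi m by rewrite /m; case: arg_maxP => // i _; apply.
suff key u : phi u = phi m by move=> u v; rewrite !key.
apply/eqP; rewrite eq_le hm /= leNgt; apply/negP => um.
have [b1 b2 _] := slice (phi m) (qst_semistable d1 q1) (qst_semistable d2 q2)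
  d2 h1 h2 hl.
have uV : u \in below phi (phi m) by rewrite inE.
have mV : m \notin below phi (phi m) by rewrite inE ltxx.
have [|_ p1] := q1 (below phi (phi m)).
  by rewrite properT; apply: contraNneq mV => ->; rewrite inE.
have [|_ p2] := q2 (~: below phi (phi m))%SET.
  rewrite properT; apply: contraTneq uV => VT.
  by rewrite -[below _ _]finset.setCK VT !inE.
have [v0V|v0V] := boolP (v0 \in below phi (phi m)).
  by have := p1 v0V; rewrite b1 ltxx.
by have := p2; rewrite b2 ltxx finset.in_setC v0V => /(_ isT).
Qed.

End Slices.

(** * Faces *)

Section Faces.
Context {R : realType} {G : graph}.
Variables (mu : gV G -> R) (len : gE G -> R).
Hypothesis len_gt0 : forall e, 0 < len e.
Implicit Types (E : {set gE G}) (a : gV G -> int) (V : {set gV G})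
  (x : gE G -> R) (c : gE G -> bool) (phi : gV G -> R).

Local Notation stab := (stab mu).
Local Notation semistable := (semistable mu).
Local Notation pst := (pst mu).
Local Notation qst := (qst mu).
Local Notation balanced := (balanced mu).
Local Notation box := (box len).
Local Notation lin_equiv_by := (lin_equiv_by len).

Lemma bdB (k k' : gE G -> int) v :
  boundary (fun e => k e - k' e) v = boundary k v - boundary k' v.
Proof. by rewrite /boundary -sumrB; apply: eq_bigr => e _; rewrite mulrBl. Qed.

Lemma bdD (k k' : gE G -> int) v :
  boundary (fun e => k e + k' e) v = boundary k v + boundary k' v.
Proof. by rewrite /boundary -big_split; apply: eq_bigr => e _; rewrite mulrDl. Qed.

Lemma eq_bd (k k' : gE G -> int) v : k =1 k' -> boundary k v = boundary k' v.
Proof. by move=> kk; apply: eq_bigr => e _; rewrite kk. Qed.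

Lemma bd0 v : boundary (fun _ : gE G => 0) v = 0.
Proof. by rewrite /boundary big1 // => e _; rewrite mul0r. Qed.

Lemma spec_trans E1 a1 E2 a2 E3 a3 c c' : spec E1 a1 E2 a2 c ->
  spec E2 a2 E3 a3 c' -> spec E1 a1 E3 a3 (fun e => if e \in E2 then c' e else c e).
Proof.
move=> [s12 h12] [s23 h23]; split; first exact: fintype.subset_trans s23 s12.
move=> v; rewrite h23 h12 -addrA -opprD -bdD; congr (_ - _); apply: eq_bd => e.
move/fintype.subsetP: s12 => /(_ e); move/fintype.subsetP: s23 => /(_ e).
case: (e \in E1); case: (e \in E2); case: (e \in E3) => //= h h';
  by [have := h isT|have := h' isT|case: (c e)|case: (c' e)].
Qed.

Lemma spec_refl E a c : spec E a E a c.
Proof.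
split => // v; rewrite (@eq_bd _ (fun=> 0)) ?bd0 ?subr0 // => e.
by case: (e \in E).
Qed.

Lemma lineqv_refl a x : lin_equiv_by (fun=> 0) (fun=> 0) a x a x.
Proof. by split => [v|e]; rewrite ?bd0 ?subrr // mul0r add0r subrr. Qed.

Lemma lineqv_sym k phi a1 x1 a2 x2 : lin_equiv_by k phi a1 x1 a2 x2 ->
  lin_equiv_by (fun e => - k e) (fun v => - phi v) a2 x2 a1 x1.
Proof.
move=> [h1 h2]; split=> [v|e].
  rewrite (@eq_bd _ (fun e => 0 - k e)) => [|e]; last by rewrite sub0r.
  by rewrite bdB bd0 sub0r -h1 opprB.
rewrite rmorphN /= -opprD -opprB -h2; ring.
Qed.

Lemma lineqv_trans k phi k' phi' a1 x1 a2 x2 a3 x3 :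
  lin_equiv_by k phi a1 x1 a2 x2 -> lin_equiv_by k' phi' a2 x2 a3 x3 ->
  lin_equiv_by (fun e => k e + k' e) (fun v => phi v + phi' v) a1 x1 a3 x3.
Proof.
move=> [h1 h2] [h1' h2']; split=> [v|e]; first by rewrite bdD -h1 -h1'; ring.
have := h2 e; have := h2' e; rewrite rmorphD /= => + +; lra.
Qed.

Definition face_fun E1 E2 c x e : R :=
  if e \in E2 then x e else if e \in E1 then (if c e then len e else 0) else 0.

Lemma fface_box E1 E2 c x : E2 \subset E1 -> box E2 x -> box E1 (face_fun E1 E2 c x).
Proof.
move=> /fintype.subsetP sE hx e; rewrite /face_fun; have [h2 _] := hx e.
case: ifP => [e2|_]; first by rewrite sE // h2.
case: (e \in E1) => //; split => // _.
by case: (c e); rewrite lexx ltW.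
Qed.

Lemma fface_lineqv E1 a1 E2 a2 c x : spec E1 a1 E2 a2 c -> box E2 x ->
  lin_equiv_by (fun e => [&& e \in E1, e \notin E2 & c e]%:R) (fun=> 0)
    a1 (face_fun E1 E2 c x) a2 x.
Proof.
move=> [sE h] hx; split => [v|e]; first by rewrite h subKr.
rewrite /face_fun rmorph_nat subrr; have [_ x0] := hx e.
case: (e \in E2) x0 => /= [_|->//].
  by rewrite andbF mul0r add0r subrr.
by case: (e \in E1); case: (c e) => /=; rewrite ?mul1r ?mul0r ?addr0 ?subrr.
Qed.

Lemma fface_comp E1 E2 E3 c c' x : E2 \subset E1 -> E3 \subset E2 ->
  face_fun E1 E2 c (face_fun E2 E3 c' x) =1
  face_fun E1 E3 (fun e => if e \in E2 then c' e else c e) x.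
Proof.
move=> /fintype.subsetP s12 /fintype.subsetP s23 e; rewrite /face_fun.
move: (s12 e) (s23 e).
case: (e \in E1); case: (e \in E2); case: (e \in E3) => //= h h';
  by [have := h isT|have := h' isT].
Qed.

(** [red_edges], [red_base] and [red_pt] describe the smallest face containing a point of a cube:
    coordinates at an endpoint of their interval are specialized away, and the remaining ones are
    interior. *)
Definition red_edges x : {set gE G} := [set e | 0 < x e < len e]%SET.

Definition red_base a x (v : gV G) : int :=
  a v - boundary (fun e => (x e == len e)%:R) v.

Definition red_pt x e : R := if e \in red_edges x then x e else 0.

Lemma red_ptP x : box (red_edges x) (red_pt x).
Proof.
move=> e; rewrite /red_pt; split=> [eE|/negbTE ->//].
by rewrite eE; move: eE; rewrite inE => /andP[/ltW -> /ltW ->].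
Qed.

Lemma red_spec E a x : box E x ->
  spec E a (red_edges x) (red_base a x) (fun e => x e == len e).
Proof.
move=> hx; have sE : red_edges x \subset E.
  apply/fintype.subsetP => e; rewrite inE => /andP[x0 _].
  by apply: contraLR x0 => eE; rewrite (hx e).2 // ltxx.
split=> // v; congr (_ - _); apply: eq_bd => e; rewrite inE.
have [xl|_] := eqVneq (x e) (len e); last by rewrite !andbF.
rewrite xl ltxx !andbF !andbT /=; have [//|eE] := boolP (e \in E).
by have := len_gt0 e; rewrite -xl (hx e).2 // ltxx.
Qed.

Lemma red_face E x : box E x ->
  face_fun E (red_edges x) (fun e => x e == len e) (red_pt x) =1 x.
Proof.
move=> hx e; rewrite /face_fun /red_pt inE; have [h1 h2] := hx e.
have [//|xl] := boolP (0 < x e < len e).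
case: ifP => eE; last by rewrite h2 // eE.
have [->//|xl'] := eqVneq (x e) (len e).
have /andP[x0 x1] := h1 eE; move: xl; rewrite lt_neqAle eq_sym x0 andbT.
by rewrite lt_neqAle x1 andbT xl' andbT => /negbNE/eqP.
Qed.

(** Both coordinates lie in [[0, l]], so the slope is -1, 0 or 1. A nonzero slope puts them at
    opposite endpoints, and slope zero makes them equal. *)
Lemma edge_flat (k : int) (l y1 y2 : R) : 0 < l -> 0 <= y1 <= l ->
  0 <= y2 <= l -> k%:~R * l + y2 - y1 = 0 ->
  [/\ k = (y1 == l)%:R - (y2 == l)%:R, (0 < y1 < l) = (0 < y2 < l) &
      0 < y1 < l -> y1 = y2].
Proof.
move=> l0 /andP[y10 y1l] /andP[y20 y2l] hk.
have k1 : k%:~R <= 1%:~R :> R by rewrite -(ler_pM2r l0) mul1r; lra.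
have k2 : (-1)%:~R <= k%:~R :> R by rewrite -(ler_pM2r l0) mulN1r; lra.
rewrite ler_int in k1; rewrite ler_int in k2.
have : [|| k == -1, k == 0 | k == 1] by lia.
case/or3P => /eqP kE; move: hk; rewrite kE.
- rewrite mulN1r => hk; have -> : y2 = l by lra.
  have -> : y1 = 0 by lra.
  by rewrite eqxx !ltxx !andbF (lt_eqF l0).
- rewrite mul0r => hk; have -> : y2 = y1 by lra.
  by rewrite subrr.
- rewrite mul1r => hk; have -> : y2 = 0 by lra.
  have -> : y1 = l by lra.
  by rewrite eqxx !ltxx !andbF (lt_eqF l0).
Qed.

Lemma box_le E x e : box E x -> 0 <= x e <= len e.
Proof.
move=> /(_ e)[h1 h2]; have [/h1//|/h2 ->] := boolP (e \in E).
by rewrite lexx ltW.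
Qed.

(** Linearly equivalent points whose potential has zero differential have the same smallest face and
    the same position in it; this is how linear equivalence is turned back into gluing. *)
Lemma lineqv_flat E1 a1 x1 E2 a2 x2 k phi : box E1 x1 -> box E2 x2 ->
  lin_equiv_by k phi a1 x1 a2 x2 -> (forall e, phi (gtgt e) = phi (gsrc e)) ->
  [/\ red_edges x1 = red_edges x2, red_base a1 x1 =1 red_base a2 x2 &
      red_pt x1 =1 red_pt x2].
Proof.
move=> b1 b2 [h1 h2] hphi.
have key e : [/\ k e = (x1 e == len e)%:R - (x2 e == len e)%:R,
    (0 < x1 e < len e) = (0 < x2 e < len e) & 0 < x1 e < len e -> x1 e = x2 e].
  apply: edge_flat (len_gt0 e) (box_le e b1) (box_le e b2) _.
  by rewrite h2 hphi subrr.
have rE : red_edges x1 = red_edges x2.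
  by apply/setP => e; rewrite !inE; have [] := key e.
split=> // [v|e].
  rewrite /red_base; have := h1 v.
  rewrite (@eq_bd _ (fun e => (x1 e == len e)%:R - (x2 e == len e)%:R)) ?bdB => [|e].
    by lra.
  by have [] := key e.
rewrite /red_pt -rE inE; have [_ _] := key e.
by case: ifP => // _ ->.
Qed.

(** Together with [add_cut_base] this places a chip on each edge of the cut not yet in [E], in such
    a way that contracting each of them to its end in [V] gives back [a]. *)
Definition add_cut E V : {set gE G} := E :|: cut_edges V.

Definition add_cut_base E a V (v : gV G) : int := a v +
  boundary (fun e => [&& e \in cut_edges V, e \notin E & gtgt e \in V]%:R) v.

Lemma add_cut_spec E a V :
  spec (add_cut E V) (add_cut_base E a V) E a (fun e => gtgt e \in V).
Proof.
split=> [|v]; first exact: finset.subsetUl.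
rewrite /add_cut_base -addrA -bdB (@eq_bd _ (fun=> 0)) ?bd0 ?addr0 // => e.
by rewrite finset.in_setU; case: (e \in E); case: (_ \in cut_edges V); rewrite ?subrr.
Qed.

(** An uncrossing identity, verified vertex by vertex and edge by edge. Its right-hand side is
    nonnegative for semistable pairs, so adding a cut of zero stability preserves semistability. *)
Lemma add_cut_bet E a V W : stab E a V = 0 ->
  stab (add_cut E V) (add_cut_base E a V) W = stab E a (V :&: W) + stab E a (V :|: W).
Proof.
have hv (f : gV G -> R) : \sum_v (v \in V :&: W)%:R * f v +
    \sum_v (v \in V :|: W)%:R * f v =
    \sum_v (v \in V)%:R * f v + \sum_v (v \in W)%:R * f v.
  rewrite -!big_split; apply: eq_bigr => v _.
  by rewrite !inE; case: (v \in V); case: (v \in W) => /=; ring.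
have := hv (fun v => (a v)%:~R - mu v); rewrite /stab => {}hv + .
under [X in _ -> X + _ = _]eq_bigr do rewrite /add_cut_base rmorphD /= addrAC mulrDr.
rewrite big_split /= sum_bd.
have : \sum_e [&& e \in cut_edges V, e \notin E & gtgt e \in V]%:R%:~R *
    ((gtgt e \in W)%:R - (gsrc e \in W)%:R) +
    \sum_e edge_term (e \in add_cut E V) (gsrc e \in W) (gtgt e \in W) +
    \sum_e edge_term (e \in E) (gsrc e \in V) (gtgt e \in V) =
    \sum_e edge_term (e \in E) (gsrc e \in V :&: W) (gtgt e \in V :&: W) +
    \sum_e edge_term (e \in E) (gsrc e \in V :|: W) (gtgt e \in V :|: W) :> R.
  rewrite -!big_split /=; apply: eq_bigr => e _.
  rewrite !inE; case: (e \in E); case: (gsrc e \in V); case: (gtgt e \in V);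
    case: (gsrc e \in W); case: (gtgt e \in W); rewrite /edge_term /=; by field.
by move: hv; lra.
Qed.

End Faces.

(** * Polystable representatives *)

Section Polystable.
Context {R : realType} {G : graph}.
Variables (mu : gV G -> R) (len : gE G -> R).
Hypothesis len_gt0 : forall e, 0 < len e.
Implicit Types (E : {set gE G}) (a : gV G -> int) (V : {set gV G})
  (x : gE G -> R) (c : gE G -> bool) (phi : gV G -> R).

Local Notation stab := (stab mu).
Local Notation semistable := (semistable mu).
Local Notation pst := (pst mu).
Local Notation balanced := (balanced mu).
Local Notation box := (box len).
Local Notation lin_equiv_by := (lin_equiv_by len).
Local Notation face_fun := (face_fun len).

Lemma semistable_pst E a : semistable E a -> pst E a \/
  exists V, ~~ (cut_edges V \subset E) /\ stab E a V = 0.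
Proof.
move=> sE; have [h|h] := pselect (exists V,
  ~~ (cut_edges V \subset E) /\ stab E a V = 0); first by right.
left=> V; split=> [|cV]; first exact: sE.
rewrite lt_neqAle sE andbT; apply/eqP => b0.
by apply: h; exists V.
Qed.

Lemma card_add_cut E V : ~~ (cut_edges V \subset E) ->
  (#|~: add_cut E V| < #|~: E|)%N.
Proof.
move=> /subsetPn[e eV eE]; apply: proper_card; apply/properP; split.
  by rewrite finset.setCS finset.subsetUl.
by exists e; rewrite !inE ?eE // (negbTE eE) /= negbK; move: eV; rewrite inE.
Qed.

(** Induction on the number of edges outside [E]: as long as a cut not contained in [E] has zero
    stability, [add_cut] absorbs it. *)
Lemma pst_generization E a : semistable E a ->
  exists E' a' c, pst E' a' /\ spec E' a' E a c.
Proof.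
have [n] := ubnP #|~: E|%SET; elim: n E a => // n ih E a nE sE.
have [pE|[V [cV bV]]] := semistable_pst sE.
  by exists E, a, (fun=> false); split => //; exact: spec_refl.
have [||E' [a' [c [pE' hE']]]] := ih (add_cut E V) (add_cut_base E a V).
- by apply: leq_trans (card_add_cut cV) _; rewrite -ltnS.
- by move=> W; rewrite add_cut_bet // addr_ge0.
do 3 eexists; split; first exact: pE'.
exact: spec_trans hE' (add_cut_spec _ _ _).
Qed.

(** Stability drops under generization, so it vanishes on [V] for the polystable pair too; hence the
    cut lies in [E1], and the equality case fixes [c] on its removed edges. The specialization
    therefore factors through [add_cut]. *)
Lemma spec_add_cut E1 a1 E a c V : pst E1 a1 -> spec E1 a1 E a c ->
  stab E a V = 0 ->
  spec E1 a1 (add_cut E V) (add_cut_base E a V) c /\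
  forall e, e \in cut_edges V -> e \notin E -> c e = (gtgt e \in V).
Proof.
move=> p1 h bV; have [p0 ps] := p1 V.
have b1 : stab E1 a1 V = 0.
  by apply/eqP; rewrite eq_le p0 andbT -bV; exact: spec_bet_le h.
have cV : cut_edges V \subset E1.
  by apply: contraT => /ps; rewrite b1 ltxx.
have ce e : e \in cut_edges V -> e \notin E -> c e = (gtgt e \in V).
  move=> eV eE; apply: (spec_bet_eq (mu := mu) h) => //; first by rewrite b1 bV.
    exact: (fintype.subsetP cV).
  by move: eV; rewrite inE.
split => //; have [sE aE] := h; split=> [|v].
  by rewrite finset.subUset sE.
rewrite /add_cut_base aE.
suff : boundary (fun e => [&& e \in E1, e \notin E & c e]%:R) v =
    boundary (fun e => [&& e \in E1, e \notin add_cut E V & c e]%:R +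
      [&& e \in cut_edges V, e \notin E & gtgt e \in V]%:R) v.
  by rewrite bdD; lra.
apply: eq_bd => e; move: (ce e) => {}ce.
move/fintype.subsetP: cV => /(_ e); rewrite finset.in_setU.
case: (e \in E) ce => /=; first by rewrite !andbF.
case: (e \in cut_edges V) => /= [/(_ isT isT) -> /(_ isT) ->|_ _].
  by rewrite add0r.
by rewrite addr0.
Qed.

(** Enlarging [E3] by the cuts on which the stability function vanishes is
    forced inside every polystable generization, so that it reaches a polystable
    pseudo-divisor lying under both given ones. *)
Lemma common_generization E1 a1 c1 E2 a2 c2 E3 a3 x3 :
  pst E1 a1 -> pst E2 a2 -> spec E1 a1 E3 a3 c1 -> spec E2 a2 E3 a3 c2 ->
  box E3 x3 -> exists E a x, [/\ pst E a, box E x, spec E1 a1 E a c1 /\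
    spec E2 a2 E a c2, face_fun E1 E c1 x =1 face_fun E1 E3 c1 x3 &
    face_fun E2 E c2 x =1 face_fun E2 E3 c2 x3].
Proof.
move=> p1 p2; have [n] := ubnP #|~: E3|%SET; elim: n E3 a3 x3 => // n ih E a x nE.
move=> h1 h2 hx.
have [pE|[V [cV bV]]] := semistable_pst (spec_semistable h1 (pst_semistable p1)).
  by exists E, a, x.
have [h1' ce1] := spec_add_cut p1 h1 bV; have [h2' ce2] := spec_add_cut p2 h2 bV.
pose x' := face_fun (add_cut E V) E (fun e => gtgt e \in V) x.
have [||||E' [a' [y [pE' hy sp f1 f2]]]] := ih (add_cut E V) (add_cut_base E a V) x'.
- by apply: leq_trans (card_add_cut cV) _; rewrite -ltnS.
- by [].
- by [].
- by apply: fface_box => //; exact: finset.subsetUl.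
have xE (F : {set gE G}) c' : add_cut E V \subset F ->
    (forall e, e \in cut_edges V -> e \notin E -> c' e = (gtgt e \in V)) ->
    face_fun F (add_cut E V) c' x' =1 face_fun F E c' x.
  move=> s ce e; rewrite fface_comp //; last exact: finset.subsetUl.
  rewrite /face_fun finset.in_setU; have [//|eE] := boolP (e \in E).
  case: (e \in F) => //=; have [eV|//] := boolP (e \in cut_edges V).
  by rewrite ce.
exists E', a', y; split=> // e; first by rewrite f1 xE //; case: h1'.
by rewrite f2 xE //; case: h2'.
Qed.

Lemma pst_unique E1 a1 x1 E2 a2 x2 k phi : pst E1 a1 -> pst E2 a2 ->
  balanced a2 -> box E1 x1 -> box E2 x2 -> lin_equiv_by k phi a1 x1 a2 x2 ->
  (forall e, e \notin E1 -> phi (gtgt e) = phi (gsrc e)) /\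
  exists E a x c1 c2, [/\ pst E a, box E x, spec E1 a1 E a c1 /\
    spec E2 a2 E a c2,
    forall e, face_fun E1 E c1 x e = x1 e + (phi (gtgt e) - phi (gsrc e)) &
    face_fun E2 E c2 x =1 x2].
Proof.
move=> p1 p2 d2 b1 b2 hl.
have sl := slice len_gt0 _ (pst_semistable p1) (pst_semistable p2) d2 b1 b2 hl.
have ne e : phi (gtgt e) != phi (gsrc e) -> [/\ e \in E1, e \in E2 & k e = 0].
  (* At this level exactly the lower end of [e] is in the sublevel set. Vanishing stability puts the
     cut inside both edge sets, and then the extreme slope is 0. *)
  move=> ne; pose tau := Num.max (phi (gsrc e)) (phi (gtgt e)).
  have [z1 z2 ke] := sl tau; set V := below phi tau in z1 z2 ke.
  have eV : (gsrc e \in V) != (gtgt e \in V).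
    rewrite !inE /tau; case: (ltgtP (phi (gsrc e)) (phi (gtgt e))) => [lt|gt|eq].
    - by rewrite lt ltxx.
    - by rewrite gt ltxx.
    - by rewrite eq eqxx in ne.
  have e1 : e \in E1.
    have [_ ps] := p1 V; have : cut_edges V \subset E1.
      by apply: contraT => /ps; rewrite z1 ltxx.
    by move/fintype.subsetP; apply; rewrite inE.
  have e2 : e \in E2.
    have [_ ps] := p2 (~: V)%SET; have : cut_edges (~: V)%SET \subset E2.
      by apply: contraT => /ps; rewrite z2 ltxx.
    move/fintype.subsetP; apply; rewrite inE !finset.in_setC.
    by move: eV; case: (_ \in V); case: (_ \in V).
  by split=> //; rewrite ke // e1 e2; case: ifP => _; rewrite subrr.
(* Shifting the first point by the differential of [phi] keeps it in its cube, since the moved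
   coordinates become those of [x2]; the remaining equivalence has zero potential. *)
pose x1' e := x1 e + (phi (gtgt e) - phi (gsrc e)).
have b1' : box E1 x1'.
  move=> e; rewrite /x1'.
  have [ee|/ne[e1 e2 k0]] := eqVneq (phi (gtgt e)) (phi (gsrc e)).
    by rewrite ee subrr addr0.
  split=> [_|]; last by rewrite e1.
  have := hl.2 e; rewrite k0 mul0r add0r => <-; rewrite addrC subrK.
  by have [h _] := b2 e; exact: h.
have hl' : lin_equiv_by k (fun=> 0) a1 x1' a2 x2.
  split=> [v|e]; first by rewrite (hl.1 v).
  by rewrite /x1'; have := hl.2 e; lra.
have [rE rA rP] := lineqv_flat len_gt0 b1' b2 hl' (fun=> erefl).
split=> [e e1|].
  by apply/eqP; apply: contraT => /ne[]; rewrite (negbTE e1).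
have s1 := red_spec len_gt0 a1 b1'; have s2 := red_spec len_gt0 a2 b2.
have s2' : spec E2 a2 (red_edges len x1') (red_base len a1 x1') (fun e => x2 e == len e).
  by case: s2 => ? h; split; rewrite rE // => v; rewrite rA.
have [E [a [x [pE hx sp f1 f2]]]] :=
  common_generization p1 p2 s1 s2' (red_ptP len x1').
exists E, a, x; do 2 eexists; split; [exact: pE|exact: hx|exact: sp| |] => e.
  by rewrite f1 red_face.
by rewrite f2 -(red_face b2) rE /face_fun rP.
Qed.

End Polystable.

(** * Potentials *)

Section Lattice.
Context {R : realType} {G : graph}.
Implicit Types (E : {set gE G}) (V : {set gV G}) (w x y : 'rV[R]_#|gE G|)
  (phi : gV G -> R).

Lemma coordD x y e : coord (x + y) e = coord x e + coord y e.
Proof. by rewrite /coord mxE. Qed.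

Lemma coordB x y e : coord (x - y) e = coord x e - coord y e.
Proof. by rewrite /coord !mxE. Qed.

Lemma coord_sum (I : Type) (r : seq I) (P : pred I) (F : I -> 'rV[R]_#|gE G|) e :
  coord (\sum_(i <- r | P i) F i) e = \sum_(i <- r | P i) coord (F i) e.
Proof. by rewrite /coord summxE. Qed.

Lemma coordZ (a : R) x e : coord (a *: x) e = a * coord x e.
Proof. by rewrite /coord mxE. Qed.

Lemma coord_vec (f : gE G -> R) e : coord (vec f) e = f e.
Proof. by rewrite /coord mxE enum_rankK. Qed.

Lemma coord_inj x y : coord x =1 coord y -> x = y.
Proof.
move=> xy; apply/rowP => i; have := xy (enum_val i).
by rewrite /coord enum_valK.
Qed.

Lemma coord_u (e e' : gE G) : coord (u_ e' : 'rV[R]__) e = (e' == e)%:R.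
Proof.
by rewrite /coord mxE eqxx /= (inj_eq enum_rank_inj) eq_sym.
Qed.

Lemma coord_u_cut E V e : cut_edges V \subset E ->
  coord (u_cut E V : 'rV[R]__) e = (gsrc e \in V)%:R - (gtgt e \in V)%:R.
Proof.
move=> /fintype.subsetP/(_ e); rewrite inE /u_cut coordB !coord_sum => cV.
have key (P : pred (gE G)) :
    \sum_(i in E | P i) coord (u_ i : 'rV[R]__) e = ((e \in E) && P e)%:R.
  under eq_bigr do rewrite coord_u.
  have [ep|ep] := boolP ((e \in E) && P e).
    by rewrite (bigD1 e) //= eqxx big1 ?addr0 // => i /andP[_ /negbTE ->].
  by rewrite big1 // => i iP; case: eqVneq => // ie; rewrite -ie iP in ep.
rewrite !key; move: cV; case: (e \in E); case: (gsrc e \in V);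
  by case: (gtgt e \in V) => //= h; rewrite ?subrr //; have := h isT.
Qed.

(** The space divided out consists of the differentials of potentials that vanish outside [E]: the
    vector of a cut is, up to sign, the differential of an indicator function. *)
Lemma L_P E w : (w <= L_ E)%MS <-> exists phi, forall e,
  coord w e = phi (gtgt e) - phi (gsrc e) /\ (e \notin E -> coord w e = 0).
Proof.
split=> [/sub_sumsmxP[u ->]|[phi hphi]].
  have /choice[al hal] V : exists a : R, u V *m <<u_cut E V>>%MS = a *: u_cut E V.
    by apply/sub_rVP; rewrite (submx_trans (submxMl _ _)) // genmxE.
  exists (fun v => - \sum_(V : {set gV G} | cut_edges V \subset E) al V * (v \in V)%:R).
  move=> e; rewrite coord_sum; split.
    rewrite opprK addrC -sumrB; apply: eq_bigr => V cV.
    by rewrite hal coordZ coord_u_cut // mulrBr.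
  move=> eE; apply: big1 => V cV; rewrite hal coordZ coord_u_cut //.
  have : e \notin cut_edges V by apply: contra eE; exact: (fintype.subsetP cV).
  by rewrite inE negbK => /eqP ->; rewrite subrr mulr0.
pose lev v : {set gV G} := [set u | phi u == phi v]%SET.
have cl v : cut_edges (lev v) \subset E.
  apply/fintype.subsetP => e; rewrite !inE; apply: contraR => eE.
  have [h /(_ eE) h0] := hphi e; move: h; rewrite h0 => /esym/eqP.
  by rewrite subr_eq0 => /eqP ->.
(* A potential is a combination of the indicators of its level sets. Each level set is listed once
   for every vertex in it, hence the division by its cardinality. *)
have -> : w = \sum_v (- (phi v / #|lev v|%:R)) *: u_cut E (lev v).
  apply: coord_inj => e; rewrite coord_sum (hphi e).1.
  have key u : \sum_v (phi v / #|lev v|%:R) * (u \in lev v)%:R = phi u.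
    rewrite (eq_bigr (fun v => phi u / #|lev u|%:R * (v \in lev u)%:R)).
      rewrite -mulr_sumr -natr_sum -big_mkcond /= sum1_card divfK //.
      by rewrite pnatr_eq0 -lt0n; apply/card_gt0P; exists u; rewrite inE.
    move=> v _; rewrite !inE eq_sym; case: eqVneq => vu; last by rewrite !mulr0.
    by rewrite /lev vu.
  under eq_bigr do rewrite coordZ coord_u_cut // mulrBr.
  have key' u : \sum_v - (phi v / #|lev v|%:R) * (u \in lev v)%:R = - phi u.
    by under eq_bigr do rewrite mulNr; rewrite sumrN key.
  by rewrite sumrB !key' opprK addrC.
apply: summx_sub => v _; apply: scalemx_sub.
by apply: (submx_trans _ (sumsmx_sup (lev v) (cl v) (submx_refl _))); rewrite genmxE.
Qed.

Lemma proj_L_eq E x y : proj_L E x = proj_L E y <-> (x - y <= L_ E)%MS.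
Proof.
by rewrite submxE mulmxBl subr_eq0; split => /eqP.
Qed.

End Lattice.

(** * Compactness and extremal potentials *)

Section Optimum.
Context {R : realType} {G : graph}.
Variables (mu : gV G -> R) (len : gE G -> R).
Hypothesis len_gt0 : forall e, 0 < len e.
Hypothesis conn : connected_graph G.
Implicit Types (E : {set gE G}) (a : gV G -> int) (x : gE G -> R).

(** The bound is the total length of a fixed path from [v0] to [v], hence independent of the
    potential. *)
Lemma potential_bounded (v0 v : gV G) : exists2 B : R, 0 <= B &
  forall phi : gV G -> R, phi v0 = 0 ->
  (forall e, `|phi (gtgt e) - phi (gsrc e)| <= len e) -> `|phi v| <= B.
Proof.
have /connectP[p hp ->] := conn.2 v0 v.
elim/last_ind: p hp => [_|p u ih] /=.
  by exists 0 => // phi ->; rewrite normr0.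
rewrite rcons_path last_rcons => /andP[/ih[B B0 hB] /existsP[e he]].
exists (B + len e) => [|phi p0 hphi]; first by rewrite addr_ge0 // ltW.
have h1 := hB phi p0 hphi; have := hphi e.
move: h1 he; set w := last v0 p => h1.
have tri (y z : R) : `|y| <= B -> `|z - y| <= len e -> `|z| <= B + len e.
  by move=> h h'; rewrite -[z](subrK y) addrC (le_trans (ler_normD _ _)) // lerD.
by case/orP=> /andP[/eqP es /eqP et]; rewrite es et => h;
  apply: tri h1 _ => //; rewrite distrC.
Qed.

Lemma finite_slack (T : finType) (P : pred T) (F : T -> R) :
  (forall t, P t -> 0 < F t) -> exists2 eps, 0 < eps & forall t, P t -> eps <= F t.
Proof.
(* The default 1 gives a positive bound even when nothing satisfies [P]. *)
move=> F0; exists (\big[Num.min/1]_(t | P t) F t).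
  by elim/big_ind: _ => // y z y0 z0; rewrite lt_min y0.
by move=> t Pt; exact: bigmin_le_cond.
Qed.

End Optimum.

Section Existence.
Context {R : realType} {G : graph}.
Variables (mu : gV G -> R) (len : gE G -> R).
Hypothesis len_gt0 : forall e, 0 < len e.
Hypothesis conn : connected_graph G.
Implicit Types (E : {set gE G}) (a : gV G -> int) (x : gE G -> R).

(** The translates of [x] by differentials of potentials supported on [E] that
    stay in the cube form a compact set; at a point maximizing the total
    potential relative to [v0], a cut violating quasistability could still be
    pushed away from [v0]. *)
Lemma pst_to_qst (v0 : gV G) E a x : pst mu E a -> box len E x ->
  exists phi, [/\ forall e, e \notin E -> phi (gtgt e) = phi (gsrc e),
    box len E (fun e => x e + (phi (gtgt e) - phi (gsrc e))) &
    balanced mu a ->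
    let y e := x e + (phi (gtgt e) - phi (gsrc e)) in
    qst mu v0 (red_edges len y) (red_base len a y)].
Proof.
move=> pE hx.
pose ev (p : 'rV[R]_#|gV G|) v := p 0 (enum_rank v).
pose dev p e := ev p (gtgt e) - ev p (gsrc e).
(* The differential must stay between [lo] and [hi] for the translate to remain in the cube; both
   are zero outside [E], which makes the potential flat there. *)
pose lo e := if e \in E then - x e else 0.
pose hi e := if e \in E then len e - x e else 0.
pose A := [set p | ev p v0 = 0 /\ forall e, lo e <= dev p e <= hi e].
have xE e : 0 <= x e <= len e by exact: box_le hx.
have lo_hi e : lo e <= 0 /\ 0 <= hi e.
  by rewrite /lo /hi; have /andP[] := xE e; case: ifP => _; lra.
have hi_lo e : - len e <= lo e /\ hi e <= len e.
  rewrite /lo /hi; have /andP[] := xE e; have := len_gt0 e.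
  by case: ifP => _; lra.
have cev v : continuous (ev^~ v) by move=> p; exact: coord_continuous.
have cdev e : continuous (dev^~ e).
  by move=> p; exact: (continuousB (cev (gtgt e) p) (cev (gsrc e) p)).
have A0 : A 0.
  split=> [|e]; first by rewrite /ev mxE.
  by rewrite /dev /ev !mxE subrr; have [-> ->] := lo_hi e.
have Acl : closed A.
  rewrite (_ : A = (ev^~ v0) @^-1` [set 0] `&`
      \bigcap_(e in [set: gE G]) (dev^~ e) @^-1` `[lo e, hi e]); last first.
    apply/seteqP; split=> p [h1 h2]; split=> // e.
      by move=> _; rewrite /= in_itv /=; exact: h2.
    by have := h2 e I; rewrite /= in_itv.
  apply: closedI; first by apply: preimage_closed => // p _; exact: cev.
  apply: closed_bigI => e _; apply: preimage_closed => [p _|]; first exact: cdev.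
  exact: itv_closed.
have Ac : compact A.
  have /choice[B hB] v : exists B : R, forall p, A p -> `|ev p v| <= B.
    have [B _ hB] := potential_bounded len_gt0 conn v0 v.
    exists B => p [p0 hp]; apply: (hB (ev p)) => // e.
    have := hp e; have := hi_lo e; rewrite ler_norml /dev => -[? ?] /andP[? ?].
    by apply/andP; split; lra.
  have Bc : compact [set p : 'rV[R]_#|gV G| |
      forall i, p ord0 i \in `[- B (enum_val i), B (enum_val i)]].
    apply: (@rV_compact _ _ (fun i => `[- B (enum_val i), B (enum_val i)]%classic)).
    by move=> i; exact: segment_compact.
  apply: subclosed_compact Acl Bc _ => p Ap i.
  by rewrite in_itv /= -ler_norml; have := hB (enum_val i) p Ap; rewrite /ev enum_valK.
pose f (p : 'rV[R]_#|gV G|) : R := \sum_i p 0 i * 1 + 0.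
have [|p /set_mem Ap pmax] := @EVT_max_rV R _ f A (ex_intro _ 0 A0) Ac.
  apply: continuous_subspaceT; apply: lincomb_continuous => i; exact: coord_continuous.
have [p0 hp] := Ap.
exists (ev p).
have flat e : e \notin E -> ev p (gtgt e) = ev p (gsrc e).
  move=> eE; have := hp e; rewrite /lo /hi (negbTE eE) /dev => /andP[? ?]; lra.
have by_ : box len E (fun e => x e + (ev p (gtgt e) - ev p (gsrc e))).
  move=> e; split=> eE.
    have := hp e; rewrite /lo /hi eE /dev => /andP[? ?].
    by apply/andP; split; lra.
  by rewrite flat // subrr addr0 (hx e).2.
split=> // da y.
have sp := red_spec len_gt0 a by_.
move=> V; rewrite properT => VT.
split=> [|v0V]; first exact: spec_semistable sp (pst_semistable pE) V.
rewrite lt_neqAle (spec_semistable sp (pst_semistable pE)) andbT.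
apply/eqP => /esym bV.
have [b0 bs] := pE V.
have bE : stab mu E a V = 0.
  by apply/eqP; rewrite eq_le b0 andbT -bV; exact: spec_bet_le sp.
have cV : cut_edges V \subset E by apply: contraT => /bs; rewrite bE ltxx.
(* The room left at a cut edge when the potential is raised off [V]: the coordinate grows if the
   source is in [V] and shrinks otherwise. *)
pose slack e := if gsrc e \in V then len e - y e else y e.
(* By [spec_bet_eq] a coordinate at an endpoint of its interval sits at the end of the edge in [V],
   so it is free to move away from [V]. *)
have slack_gt0 e : e \in cut_edges V -> 0 < slack e.
  move=> eV; have eE := fintype.subsetP cV e eV.
  have := eV; rewrite inE => eV'.
  have [eR|eR] := boolP (e \in red_edges len y).
    by move: eR; rewrite inE /slack => /andP[? ?]; case: ifP; rewrite ?subr_gt0.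
  have := spec_bet_eq (mu := mu) sp (etrans bV (esym bE)) eE eR eV'.
  have := box_le len_gt0 e by_; rewrite -/(y e) /slack => /andP[y0 yl].
  move: eV'; case: (gsrc e \in V); case: (gtgt e \in V) => // _.
    by move/negbT; rewrite subr_gt0 lt_neqAle yl andbT => ->.
  by move/eqP => ->; exact: len_gt0.
have [eps eps0 heps] := finite_slack slack_gt0.
(* Raising the potential by [eps] outside [V] leaves it unchanged at [v0] and keeps the translate in
   the cube, yet increases the total, against maximality. *)
pose q : 'rV[R]_#|gV G| := \row_i (p 0 i + (enum_val i \notin V)%:R * eps).
have evq v : ev q v = ev p v + (v \notin V)%:R * eps by rewrite /ev mxE enum_rankK.
have Aq : A q.
  split=> [|e]; first by rewrite evq v0V mul0r addr0.
  have := hp e; rewrite /dev !evq.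
  have [eV|eV] := boolP (e \in cut_edges V); last first.
    move: eV; rewrite inE negbK => /eqP ->.
    by move=> /andP[? ?]; apply/andP; split; lra.
  have eE := fintype.subsetP cV e eV; rewrite /lo /hi eE.
  have := heps e eV; have := box_le len_gt0 e by_; rewrite -/(y e) /slack.
  move: eV; rewrite inE /y => + + + /andP[? ?].
  case: (gsrc e \in V); case: (gtgt e \in V) => //= _ /andP[? ?] ?;
    by apply/andP; split; lra.
have := pmax q (mem_set Aq); rewrite leNgt => /negP; apply.
rewrite /f !addr0 -subr_gt0 -sumrB.
move: VT; rewrite finset.eqEsubset finset.subsetT /= => /subsetPn[v _ vV].
rewrite (bigD1 (enum_rank v)) //= !mxE enum_rankK vV ltr_pwDl //.
  by rewrite /= mul1r !mulr1; lra.
apply: sumr_ge0 => i _; rewrite !mxE.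
by case: (_ \notin V) => /=; rewrite ?mul1r ?mul0r ?mulr1; lra.
Qed.

End Existence.

(** * Points of the complexes and linear equivalence *)

Section Points.
Context {R : realType} {G : graph}.
Variables (mu : gV G -> R) (len : gE G -> R) (d : int).
Hypothesis len_gt0 : forall e, 0 < len e.
Hypothesis sum_mu : \sum_v mu v = d%:~R.
Implicit Types (E : {set gE G}) (a : gV G -> int) (x y : 'rV[R]_#|gE G|).

Definition lin_equiv a x a' x' : Prop :=
  exists k phi, lin_equiv_by len k phi a (coord x) a' (coord x').

Lemma lin_refl a x : lin_equiv a x a x.
Proof. by do 2 eexists; exact: lineqv_refl. Qed.

Lemma lin_sym a x a' x' : lin_equiv a x a' x' -> lin_equiv a' x' a x.
Proof. by move=> [k [phi h]]; do 2 eexists; exact: lineqv_sym h. Qed.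

Lemma lin_trans a x a' x' a'' x'' :
  lin_equiv a x a' x' -> lin_equiv a' x' a'' x'' -> lin_equiv a x a'' x''.
Proof.
by move=> [k [phi h]] [k' [phi' h']]; do 2 eexists; exact: lineqv_trans h h'.
Qed.

Lemma lin_L E a x y : (x - y <= L_ E)%MS -> lin_equiv a x a y.
Proof.
move=> /L_P[phi h]; exists (fun=> 0), (fun v => - phi v); split=> [v|e].
  by rewrite subrr bd0.
by have [+ _] := h e; rewrite coordB => ?; rewrite mul0r; lra.
Qed.

Lemma cell_KP E x : cell_K len E x <-> box len E (coord x).
Proof. by []. Qed.

Lemma coord_face_map E1 E2 c x :
  coord (face_map len E1 E2 c x) =1 face_fun len E1 E2 c (coord x).
Proof. by move=> e; rewrite coord_vec. Qed.

Lemma face_map_cell E1 E2 c x : E2 \subset E1 -> cell_K len E2 x ->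
  cell_K len E1 (face_map len E1 E2 c x).
Proof.
move=> sE /cell_KP hx; apply/cell_KP => e; rewrite coord_face_map.
exact: fface_box.
Qed.

Lemma face_map_lin E1 a1 E2 a2 c x : spec E1 a1 E2 a2 c -> cell_K len E2 x ->
  lin_equiv a1 (face_map len E1 E2 c x) a2 x.
Proof.
move=> h hx; have [h1 h2] := fface_lineqv h hx.
exists (fun e => [&& e \in E1, e \notin E2 & c e]%:R), (fun=> 0).
by split=> // e; rewrite coord_face_map; exact: h2.
Qed.

(** Coordinates outside [E2] vanish on the cell, so the face inclusion is a translation by the
    constants it fills in. *)
Lemma face_map_affine E1 E2 c : exists b, forall x, cell_K len E2 x ->
  face_map len E1 E2 c x = x + b.
Proof.
exists (vec (fun e => if e \in E2 then 0 else
  if e \in E1 then (if c e then len e else 0) else 0)) => x hx.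
apply: coord_inj => e; rewrite coord_face_map coordD coord_vec /face_fun.
case: ifPn => eE; first by rewrite addr0.
by rewrite (hx e).2 // add0r.
Qed.

Lemma polystableP D : polystable mu D <-> pst mu (pd_edges D) (base D).
Proof. by split => h V; have := h V; rewrite betaE. Qed.

Lemma quasistableP v0 D :
  quasistable mu v0 D <-> qst mu v0 (pd_edges D) (base D).
Proof. by split => h V hV; have := h V hV; rewrite betaE. Qed.

Lemma balancedP a : balanced mu a <-> \sum_v a v = d.
Proof.
rewrite /balanced sum_mu -rmorph_sum /=; split=> [|-> //].
by move/intr_inj.
Qed.

Lemma spec_qst v0 E1 a1 E2 a2 c : spec E1 a1 E2 a2 c -> qst mu v0 E1 a1 ->
  qst mu v0 E2 a2.
Proof.
move=> h q V hV; have [q0 q1] := q V hV; have le := spec_bet_le mu V h.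
by split=> [|/q1 q2]; [exact: le_trans q0 le|exact: lt_le_trans q2 le].
Qed.

Section Quasistable.
Variable v0 : gV G.
Local Notation J := (J_complex len d mu v0).

Lemma J_idxP (D : pc_idx J) :
  qst mu v0 (pd_edges (val D)) (base (val D)) /\ balanced mu (base (val D)).
Proof.
have /asboolP[h /quasistableP q] := valP D.
by split => //; apply/balancedP; rewrite -pd_degreeE.
Qed.

Lemma J_idx E a : qst mu v0 E a -> balanced mu a ->
  exists D : pc_idx J, pd_edges (val D) = E /\ base (val D) =1 a.
Proof.
move=> q b; have aE : base (mk_pd E a) = a by apply/funext => v; exact: base_mk_pd.
have h : `[< pd_degree (mk_pd E a) = d /\ quasistable mu v0 (mk_pd E a) >].
  apply/asboolP; rewrite pd_degreeE quasistableP aE; split => //.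
  exact/balancedP.
by exists (exist _ (mk_pd E a) h); split => // v; rewrite /= aE.
Qed.

Lemma J_red (p : pc_disjoint J) (x := \val (projT2 p))
    (a := base (val (projT1 p))) :
  forall q : pc_disjoint J,
  pd_edges (val (projT1 q)) = red_edges len (coord x) ->
  base (val (projT1 q)) =1 red_base len a (coord x) ->
  coord (\val (projT2 q)) =1 red_pt len (coord x) -> pc_step q p.
Proof.
move=> q qE qa qx; have hx : box len (pd_edges (val (projT1 p))) (coord x).
  by apply/cell_KP; exact: set_valP (projT2 p).
exists (fun e => coord x e == len e).
  apply/specP; have [s1 s2] := red_spec len_gt0 a hx.
  by split; rewrite /= qE // => v; rewrite qa s2.
apply: coord_inj => e; rewrite coord_face_map.
have mE : (e \in pd_edges (val (tag q))) = (e \in red_edges len (coord x)).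
  by rewrite -qE.
apply: etrans (esym (red_face hx e)) _; rewrite /face_fun mE.
by case: ifP => // _; exact: esym (qx e).
Qed.

(** Each gluing step is a linear equivalence. Conversely the potential between quasistable points is
    constant, and both points are glued to the same point [w] of their common smallest face. *)
Lemma J_rel (p q : pc_disjoint J) : clos_refl_sym_trans _ (@pc_step _ J) p q <->
  lin_equiv (base (val (projT1 p))) (\val (projT2 p))
      (base (val (projT1 q))) (\val (projT2 q)).
Proof.
split=> [|[k [phi h]]].
  elim=> {p q} [p q [c h hx]|p|p q _|p q r _ h1 _ h2].
  - apply: lin_sym; rewrite [\val (projT2 q)]hx.
    by apply: face_map_lin; [exact/specP|exact: set_valP (projT2 p)].
  - exact: lin_refl.
  - exact: lin_sym.
  - exact: lin_trans h1 h2.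
have [q1 d1] := J_idxP (projT1 p); have [q2 d2] := J_idxP (projT1 q).
have b1 : box len (pd_edges (val (projT1 p))) (coord (\val (projT2 p))).
  by apply/cell_KP; exact: set_valP (projT2 p).
have b2 : box len (pd_edges (val (projT1 q))) (coord (\val (projT2 q))).
  by apply/cell_KP; exact: set_valP (projT2 q).
have hphi := qst_unique len_gt0 q1 q2 d1 d2 b1 b2 h.
have [rE rA rP] := lineqv_flat len_gt0 b1 b2 h (fun e => hphi _ _).
set x1 := coord _ in b1 h rE rA rP.
have s1 := red_spec len_gt0 (base (val (projT1 p))) b1.
have [D [DE DA]] := J_idx (spec_qst s1 q1) (spec_balanced s1 d1).
have hw : cell_K len (pd_edges (val D)) (vec (red_pt len x1)).
  by apply/cell_KP; rewrite DE => e; rewrite coord_vec; exact: red_ptP.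
pose w : pc_disjoint J := existT _ D (SigSub (mem_set hw)).
apply: (@rst_trans _ _ _ w); [apply: rst_sym|]; apply: rst_step; apply: J_red => //=.
- by move=> e; rewrite coord_vec.
- by rewrite DE rE.
- by move=> v; rewrite DA rA.
- by move=> e; rewrite coord_vec rP.
Qed.

End Quasistable.

Section Polystable.
Local Notation P := (P_complex len d mu).

Lemma P_idxP (D : pc_idx P) :
  pst mu (pd_edges (val D)) (base (val D)) /\ balanced mu (base (val D)).
Proof.
have /asboolP[h /polystableP q] := valP D.
by split => //; apply/balancedP; rewrite -pd_degreeE.
Qed.

Lemma P_idx E a : pst mu E a -> balanced mu a ->
  exists D : pc_idx P, pd_edges (val D) = E /\ base (val D) =1 a.
Proof.
move=> q b; have aE : base (mk_pd E a) = a by apply/funext => v; exact: base_mk_pd.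
have h : `[< pd_degree (mk_pd E a) = d /\ polystable mu (mk_pd E a) >].
  apply/asboolP; rewrite pd_degreeE polystableP aE; split => //.
  exact/balancedP.
by exists (exist _ (mk_pd E a) h); split => // v; rewrite /= aE.
Qed.

(** A lift of a point of the polytope to its cube. Two lifts differ by an element of [L_], so they
    are linearly equivalent and the class does not depend on the lift. *)
Definition P_lift (p : pc_disjoint P) x : Prop :=
  cell_K len (pd_edges (val (projT1 p))) x /\
  \val (projT2 p) = proj_L (pd_edges (val (projT1 p))) x.

Lemma P_lift_ex p : exists x, P_lift p x.
Proof. by have [x hx xE] := set_valP (projT2 p); exists x. Qed.

Lemma P_lift_lin p x y : P_lift p x -> P_lift p y ->
  lin_equiv (base (val (projT1 p))) x (base (val (projT1 p))) y.
Proof.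
move=> [_ hx] [_ hy]; apply: (lin_L (E := pd_edges (val (projT1 p)))).
by apply/proj_L_eq; rewrite -hx -hy.
Qed.

Lemma P_rel (p q : pc_disjoint P) x y : P_lift p x -> P_lift q y ->
  clos_refl_sym_trans _ (@pc_step _ P) p q <->
  lin_equiv (base (val (projT1 p))) x (base (val (projT1 q))) y.
Proof.
move=> hx hy; split=> [pq|[k [phi h]]].
  elim: pq x y hx hy => {p q}
    [p q [c h [z hz [zp zq]]]|p|p q _ ih|p q r _ h1 _ h2] x y hx hy.
  - have hf : P_lift q (face_map len (pd_edges (val (projT1 q)))
        (pd_edges (val (projT1 p))) c z).
      by split; [apply: face_map_cell => //; case: h|exact: zq].
    apply: (lin_trans (P_lift_lin hx (conj hz zp : P_lift p z))).
    apply: lin_trans (P_lift_lin hf hy); apply: lin_sym.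
    by apply: face_map_lin => //; exact/specP.
  - exact: P_lift_lin hx hy.
  - by apply: lin_sym; exact: ih.
  - have [w hw] := P_lift_ex q.
    exact: lin_trans (h1 _ _ hx hw) (h2 _ _ hw hy).
have [p1 d1] := P_idxP (projT1 p); have [p2 d2] := P_idxP (projT1 q).
have [flat [E [a [z [c1 [c2 [pE hz [s1 s2] f1 f2]]]]]]] :=
  pst_unique len_gt0 p1 p2 d2 hx.1 hy.1 h.
have [D [DE DA]] := P_idx pE (spec_balanced s1 d1).
have hv : cell_K len (pd_edges (val D)) (vec z).
  by apply/cell_KP; rewrite DE => e; rewrite coord_vec; exact: hz.
have hv' : cell_P len (pd_edges (val D)) (proj_L (pd_edges (val D)) (vec z)).
  by exists (vec z).
pose w : pc_disjoint P := existT _ D (SigSub (mem_set hv')).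
have step (r : pc_disjoint P) u c : P_lift r u ->
    spec (pd_edges (val (projT1 r))) (base (val (projT1 r))) E a c ->
    (vec (face_fun len (pd_edges (val (projT1 r))) E c z) - u <=
      L_ (pd_edges (val (projT1 r))))%MS -> pc_step w r.
  move=> [hu ru] [sr ar] /proj_L_eq hL; exists c.
    by apply/specP; split=> [|v] /=; rewrite DE // DA ar.
  exists (vec z) => //; split => //; rewrite [tagged r]/(projT2 r) ru -hL.
  congr proj_L; apply: coord_inj => e.
  by rewrite coord_vec coord_face_map /= DE /face_fun coord_vec.
apply: (@rst_trans _ _ _ w); [apply: rst_sym|]; apply: rst_step.
  (* On the side of [p] the common face misses the lift by the differential of [phi], which vanishes
     outside the edge set and so dies in the quotient; on the side of [q] it meets the lift
     exactly. *)
  apply: step hx s1 _; apply/L_P; exists phi => e.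
  rewrite coordB coord_vec f1; split; first by ring.
  by move=> /flat ->; ring.
apply: step hy s2 _; rewrite (_ : _ - _ = 0) ?sub0mx //.
by apply: coord_inj => e; rewrite coordB coord_vec f2 subrr /coord mxE.
Qed.

End Polystable.
End Points.

(** * The refinement map *)

Section Transfer.
Context {R : realType} {G0 G : graph}.
Variables (mu0 : gV G0 -> R) (len0 : gE G0 -> R).
Variables (mu : gV G -> R) (len : gE G -> R) (d : int) (v0 : gV G0).
Hypothesis len0_gt0 : forall e, 0 < len0 e.
Hypothesis len_gt0 : forall e, 0 < len e.
Hypothesis conn0 : connected_graph G0.
Hypothesis sum_mu0 : \sum_v mu0 v = d%:~R.
Hypothesis sum_mu : \sum_v mu v = d%:~R.

(** The graph [G0] has the base point as a vertex, while [G] is the graph of the polystable complex.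
    [S] transports coordinates and [corr] matches pseudo-divisors, so one argument treats both an
    old vertex and a subdivided edge. *)
Variable S : 'M[R]_(#|gE G0|, #|gE G|).
Variable corr : {set gE G0} -> (gV G0 -> int) -> {set gE G} -> (gV G -> int) ->
  Prop.
Hypothesis corr_down : forall E0 a0, pst mu0 E0 a0 -> balanced mu0 a0 ->
  exists E a, [/\ pst mu E a, balanced mu a & corr E0 a0 E a].
Hypothesis corr_up : forall E a, pst mu E a -> balanced mu a ->
  exists E0 a0, [/\ pst mu0 E0 a0, balanced mu0 a0 & corr E0 a0 E a].
Hypothesis corr_cell : forall E0 a0 E a x, corr E0 a0 E a ->
  cell_K len0 E0 x -> cell_K len E (x *m S).
Hypothesis corr_cell_onto : forall E0 a0 E a x, corr E0 a0 E a ->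
  cell_K len E x -> exists2 x0, cell_K len0 E0 x0 & x0 *m S = x.
Hypothesis corr_lin : forall E0 a0 E a x E0' a0' E' a' x',
  corr E0 a0 E a -> corr E0' a0' E' a' ->
  lin_equiv len0 a0 x a0' x' <-> lin_equiv len a (x *m S) a' (x' *m S).
Hypothesis corr_L : forall E0 a0 E a w, corr E0 a0 E a ->
  (forall e, e \notin E0 -> coord w e = 0) ->
  (w *m S <= L_ E)%MS <-> (w <= L_ E0)%MS.

Local Notation J := (J_complex len0 d mu0 v0).
Local Notation P := (P_complex len d mu).

Definition same_class (p : pc_disjoint J) (q : pc_disjoint P) : Prop :=
  exists E0 a0 x0, [/\
    corr E0 a0 (pd_edges (val (projT1 q))) (base (val (projT1 q))),
    lin_equiv len0 (base (val (projT1 p))) (\val (projT2 p)) a0 x0 &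
    P_lift q (x0 *m S)].

Lemma cell_K_compact E : compact (cell_K len0 E).
Proof.
pose B e := if e \in E then len0 e else 0.
rewrite (_ : cell_K len0 E = [set x : 'rV[R]_#|gE G0| |
    forall i, x ord0 i \in `[0, B (enum_val i)]]).
  apply: (@rV_compact _ _ (fun i => `[0, B (enum_val i)]%classic)).
  by move=> i; exact: segment_compact.
apply/seteqP; split=> x /= hx => [i|e].
  rewrite in_itv /= /B; have := hx (enum_val i); rewrite /coord enum_valK.
  by case: ifPn => _ [h1 h2]; [exact: h1|rewrite h2 // lexx].
have := hx (enum_rank e); rewrite in_itv /= enum_rankK -/(coord x e) /B.
case: (e \in E) => hxe; split=> // _; apply/eqP.
by rewrite eq_le andbC.
Qed.

Lemma P_point (D : pc_idx P) x : cell_K len (pd_edges (val D)) x ->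
  exists y : pc_cell D, \val y = proj_L (pd_edges (val D)) x.
Proof.
move=> hx; have h : cell_P len (pd_edges (val D)) (proj_L (pd_edges (val D)) x).
  by exists x.
by exists (SigSub (mem_set h)).
Qed.

Lemma face_transfer (D0 : pc_idx J) (D : pc_idx P) E0 a0 c :
  corr E0 a0 (pd_edges (val D)) (base (val D)) ->
  spec E0 a0 (pd_edges (val D0)) (base (val D0)) c ->
  exists A b,
    (forall x, cell_K len0 (pd_edges (val D0)) x ->
      proj_L (pd_edges (val D)) (face_map len0 E0 (pd_edges (val D0)) c x *m S) =
      x *m A + b) /\
    forall x : pc_cell D0, exists y : pc_cell D, \val y = \val x *m A + b /\
      same_class (existT _ D0 x) (existT _ D y).
Proof.
move=> hc hs; have [b hb] := face_map_affine len0 E0 (pd_edges (val D0)) c.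
pose K := cokermx (L_ (pd_edges (val D)) : 'M[R]_#|gE G|).
have AE x : cell_K len0 (pd_edges (val D0)) x ->
    proj_L (pd_edges (val D)) (face_map len0 E0 (pd_edges (val D0)) c x *m S) =
    x *m (S *m K) + b *m S *m K.
  by move=> hx; rewrite hb // /proj_L !mulmxDl mulmxA.
exists (S *m K), (b *m S *m K); split=> // x; have hx := set_valP x.
have hf : cell_K len (pd_edges (val D))
    (face_map len0 E0 (pd_edges (val D0)) c (\val x) *m S).
  by apply: corr_cell hc _; apply: face_map_cell => //; case: hs.
have [y yE] := P_point hf; exists y; split; first by rewrite yE AE.
exists E0, a0, (face_map len0 E0 (pd_edges (val D0)) c (\val x)); split=> //.
by apply: lin_sym; exact: face_map_lin.
Qed.

Theorem transfer_refinement : exists f : pc_space J -> pc_space P,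
  refinement_map f.
Proof.
apply: (@refinement_criterion _ _ _ same_class).
- move=> p q p' q' [E0 [a0 [x0 [hc hl hP]]]] [E0' [a0' [x0' [hc' hl' hP']]]].
  rewrite J_rel // (P_rel len_gt0 sum_mu hP hP') -(corr_lin _ _ hc hc').
  split=> h; first exact: lin_trans (lin_trans (lin_sym hl) h) hl'.
  exact: lin_trans (lin_trans hl h) (lin_sym hl').
- by move=> D; exact: cell_K_compact.
- move=> D0; have [q0 b0] := J_idxP sum_mu0 D0.
  (* The quasistable cell is a face of a polystable cube, and its affine map is the face inclusion
     followed by [S] and the projection. *)
  have [E0 [a0 [c [pE0 hs]]]] := pst_generization (qst_semistable b0 q0).
  have b0' : balanced mu0 a0.
    by rewrite /balanced -(spec_sum hs) b0.
  have [E [a [pE ba hc]]] := corr_down pE0 b0'.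
  have [D [DE /funext DA]] := P_idx len sum_mu pE ba.
  rewrite -DE -DA in hc; have [A [b [AE hA]]] := face_transfer hc hs.
  exists D, A, b; split=> // x y; rewrite !inE => hx hy.
  rewrite -AE // -AE // => /proj_L_eq; rewrite -mulmxBl.
  have [b' hb'] := face_map_affine len0 E0 (pd_edges (val D0)) c.
  rewrite !hb' // opprD addrACA subrr addr0 .
  have w0 e : e \notin E0 -> coord (x - y) e = 0.
    move=> eE; have eD : e \notin pd_edges (val D0).
      by apply: contra eE; exact: (fintype.subsetP hs.1).
    by rewrite coordB (hx e).2 // (hy e).2 // subrr.
  move=> /(corr_L hc w0)/L_P[phi hphi].
  (* Two points of the cell with equal images differ by the differential of a potential; uniqueness
     of quasistable points, applied to one pseudo-divisor twice, makes it constant. *)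
  have hl : lin_equiv_by len0 (fun=> 0) (fun v => - phi v) (base (val D0)) (coord x)
      (base (val D0)) (coord y).
    split=> [v|e]; first by rewrite subrr bd0.
    by have [+ _] := hphi e; rewrite coordB => ?; rewrite mul0r; lra.
  have hphi0 := qst_unique len0_gt0 q0 q0 b0 b0
    ((cell_KP _ _ _).1 hx) ((cell_KP _ _ _).1 hy) hl.
  apply: coord_inj => e; apply/eqP; rewrite -subr_eq0 -coordB (hphi e).1.
  by rewrite -(opprK (phi (gtgt e))) (hphi0 (gtgt e) (gsrc e)) opprK subrr.
move=> D; have [pD bD] := P_idxP sum_mu D.
have [E0 [a0 [pE0 b0 hc]]] := corr_up pD bD.
(* A face of the cube is given by an edge set and a choice of ends, so there are finitely many; [I]
   keeps those realized by a quasistable pseudo-divisor. *)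
pose Q (t : {set gE G0} * {ffun gE G0 -> bool}) (D0 : pc_idx J) :=
  spec E0 a0 (pd_edges (val D0)) (base (val D0)) t.2 /\ pd_edges (val D0) = t.1.
pose I := {t | `[< exists D0, Q t D0 >]}.
have ex (t : I) : exists z : pc_idx J * ('M[R]_(#|gE G0|, #|gE G|) * 'rV[R]_#|gE G|),
  [/\ Q (val t) z.1,
    (forall x, cell_K len0 (pd_edges (val z.1)) x ->
      proj_L (pd_edges (val D))
        (face_map len0 E0 (pd_edges (val z.1)) (val t).2 x *m S) =
      x *m z.2.1 + z.2.2) &
    forall x : pc_cell z.1, exists y : pc_cell D,
      \val y = \val x *m z.2.1 + z.2.2 /\
      same_class (existT _ z.1 x) (existT _ D y)].
  have /asboolP[D0 hD0] := valP t; have [A [b [AE hA]]] := face_transfer hc hD0.1.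
  by exists (D0, (A, b)).
have [z hz] := choice ex.
exists I, (fun t => (z t).1), (fun t => (z t).2.1), (fun t => (z t).2.2); split.
  by move=> t; have [_ _] := hz t.
move=> y; have [u hu uy] := set_valP y.
have [x0 hx0 x0u] := corr_cell_onto hc hu.
(* Moving the lift by a potential flat outside [E0] does not change its projection and brings it to
   a point whose smallest face is quasistable. *)
have [phi [phi0 hbox]] := pst_to_qst len0_gt0 conn0 v0 pE0 ((cell_KP _ _ _).1 hx0).
move=> /(_ b0); set w := fun e => _ => qw.
have sw := red_spec len0_gt0 a0 hbox; rewrite -/w in sw hbox.
have [D0 [DE DA]] := J_idx len0 sum_mu0 qw (spec_balanced sw b0).
have hI : `[< exists D0, Q (red_edges len0 w, [ffun e => w e == len0 e]) D0 >].
  apply/asboolP; exists D0; split=> //=; rewrite DE (funext DA).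
  case: sw => sE h; split=> // v; rewrite h; congr (_ - _).
  by apply: eq_bd => e; rewrite ffunE.
pose t : I := exist (fun t => is_true `[< exists D0, Q t D0 >]) _ hI.
have [[hs hE] AE _] := hz t.
have hr : cell_K len0 (pd_edges (val (z t).1)) (vec (red_pt len0 w)).
  by apply/cell_KP; rewrite hE => e; rewrite coord_vec; exact: red_ptP.
exists t, (SigSub (mem_set hr)); rewrite /= -AE // -uy -x0u; apply/proj_L_eq.
have FE e : coord (face_map len0 E0 (pd_edges (val (z t).1)) (val t).2
    (vec (red_pt len0 w))) e = w e.
  rewrite coord_face_map -[RHS](red_face hbox) /face_fun hE /= ffunE coord_vec.
  by [].
rewrite -mulmxBl; apply/(corr_L hc) => [e eE|].
  by rewrite coordB FE (hx0 e).2 // (hbox e).2 // subrr.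
apply/L_P; exists (fun v => - phi v) => e; rewrite coordB FE /w; split; first by ring.
by move=> /phi0 ->; ring.
Qed.

End Transfer.

(** * Subdividing an edge *)

Lemma refinement_same_graph (R : realType) (G : graph) (mu : gV G -> R)
    (len : gE G -> R) (d : int) (v0 : gV G) : (forall e, 0 < len e) ->
  connected_graph G -> \sum_v mu v = d%:~R ->
  exists f : pc_space (J_complex len d mu v0) -> pc_space (P_complex len d mu),
    refinement_map f.
Proof.
move=> len_gt0 conn sum_mu.
apply: (@transfer_refinement _ _ _ _ _ _ _ _ _ len_gt0 len_gt0 conn sum_mu sum_mu
  1%:M (fun E a E' a' => E = E' /\ a = a')).
- by move=> E a; exists E, a.
- by move=> E a; exists E, a.
- by move=> E a E' a' x [<- _] hx; rewrite mulmx1.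
- by move=> E a E' a' x [-> _] hx; exists x; rewrite ?mulmx1.
- by move=> E a E' a' x F b F' b' y [_ <-] [_ <-]; rewrite !mulmx1.
- by move=> E a E' a' w [<- _] _; rewrite mulmx1.
Qed.

Section Subdivision.
Context {R : realType} {G : graph}.
Variables (mu : gV G -> R) (len : gE G -> R) (d : int).
Hypothesis len_gt0 : forall e, 0 < len e.
Variables (e0 : gE G) (y0 : R).
Hypothesis hy0 : 0 < y0 < len e0.

Local Notation H := (subdiv [set e0]%SET).

Variables (muH : gV H -> R) (lenH : gE H -> R).
Hypothesis muH_old : forall v, muH (inl v) = mu v.
Hypothesis muH_new : forall e, muH (inr e) = 0.
Hypothesis lenH_old : forall e, lenH (inl e) = len (val e).
Hypothesis lenH_src : forall e, lenH (inr (e, false)) = y0.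
Hypothesis lenH_tgt : forall e, lenH (inr (e, true)) = len e0 - y0.

Let e0' : {e | e \in [set e0]%SET} := exist _ e0 (set11 e0).
Let es : gE H := inr (e0', false).
Let et : gE H := inr (e0', true).
Let q : gV H := inr e0'.

Local Lemma e0'E (e : {e | e \in [set e0]%SET}) : e = e0'.
Proof. by apply: val_inj; case: e => e /=; rewrite inE => /eqP. Qed.

Local Lemma old_neq (e : {e | e \notin [set e0]%SET}) : val e <> e0.
Proof. by move=> h; have := valP e; rewrite inE => /eqP. Qed.

Lemma subdiv_edge_ind (P : gE H -> Prop) :
  (forall e, P (inl e)) -> P es -> P et -> forall e, P e.
Proof. by move=> h1 h2 h3 [//|[e b]]; rewrite (e0'E e); case: b. Qed.

Lemma subdiv_vertex_ind (P : gV H -> Prop) :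
  (forall v, P (inl v)) -> P q -> forall v, P v.
Proof. by move=> h1 h2 [//|e]; rewrite (e0'E e). Qed.

Lemma edge_ind (P : gE G -> Prop) :
  (forall e : {e | e \notin [set e0]%SET}, P (val e)) -> P e0 -> forall e, P e.
Proof.
move=> h1 h2 e; have [->//|ne] := eqVneq e e0.
by have ne' : e \notin [set e0]%SET; [rewrite inE|exact: h1 (exist _ e ne')].
Qed.

Lemma sum_subdiv_edge (S : nmodType) (F : gE H -> S) :
  \sum_e F e = \sum_e F (inl e) + (F es + F et).
Proof.
rewrite big_sumType; congr (_ + _).
rewrite (bigD1 (e0', false)) //= (bigD1 (e0', true)) /=; last by apply/eqP => -[].
rewrite big1 ?addr0 // => -[e b]; rewrite (e0'E e).
by case: b; rewrite eqxx ?andbF.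
Qed.

Lemma sum_subdiv_vertex (S : nmodType) (F : gV H -> S) :
  \sum_v F v = \sum_v F (inl v) + F q.
Proof.
rewrite big_sumType; congr (_ + _).
by rewrite (big_pred1 e0') // => e; rewrite (e0'E e); exact: esym (eqxx _).
Qed.

Lemma sum_edge (S : nmodType) (F : gE G -> S) :
  \sum_e F e = \sum_(e : {e | e \notin [set e0]%SET}) F (val e) + F e0.
Proof.
rewrite (sum_sub [pred e | e \notin [set e0]%SET] F) (bigD1 e0) //= addrC.
by congr (_ + _); apply: eq_bigl => e; rewrite !inE.
Qed.

Definition subdiv_proj (e : gE H) : gE G :=
  match e with inl e => val e | inr (e, _) => val e end.

(** Adds the coordinates of the two halves of [e0]: the distances slid along them make up the
    distance slid along [e0]. *)
Definition proj_mx : 'M[R]_(#|gE H|, #|gE G|) :=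
  \matrix_(i, j) (subdiv_proj (enum_val i) == enum_val j)%:R.

Lemma coord_proj_mx (x : 'rV[R]_#|gE H|) e :
  coord (x *m proj_mx) e = \sum_e' coord x e' * (subdiv_proj e' == e)%:R.
Proof.
rewrite /coord mxE (reindex (enum_rank : gE H -> _)) /=; last first.
  by apply: onW_bij; exact: enum_rank_bij.
by apply: eq_bigr => e' _; rewrite mxE !enum_rankK.
Qed.

Lemma coord_proj_old (x : 'rV[R]_#|gE H|) (e : {e | e \notin [set e0]%SET}) :
  coord (x *m proj_mx) (val e) = coord x (inl e).
Proof.
have /negbTE ne : e0 != val e by have := valP e; rewrite inE eq_sym.
rewrite coord_proj_mx sum_subdiv_edge /= ne !mulr0 !addr0 (bigD1 e) //= eqxx.
by rewrite mulr1 big1 ?addr0 // => e' /negbTE; rewrite -val_eqE /= => ->; rewrite mulr0.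
Qed.

Lemma coord_proj_new (x : 'rV[R]_#|gE H|) :
  coord (x *m proj_mx) e0 = coord x es + coord x et.
Proof.
rewrite coord_proj_mx sum_subdiv_edge /= eqxx !mulr1 big1 ?add0r // => e _.
by have /negbTE -> : val e != e0 by [have := valP e; rewrite inE]; rewrite mulr0.
Qed.

(** The edge [e0] carries a chip exactly when both halves of it do, and then the
    new vertex carries a compensating positive chip. *)
Definition subdiv_corr (E0 : {set gE H}) (a0 : gV H -> int) (E : {set gE G})
    (a : gV G -> int) : Prop :=
  [/\ forall e, (inl e \in E0) = (val e \in E), (es \in E0) = (e0 \in E),
      (et \in E0) = (e0 \in E), a0 q = 0 & forall v, a0 (inl v) = a v].

Definition trace (W : {set gV H}) : {set gV G} := [set v | inl v \in W]%SET.

(** The extra 1 appears when the new vertex is separated from both ends of a chip-free [e0]: two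
    halves are then cut, each worth one half. *)
Lemma subdiv_bet E0 a0 E a W : subdiv_corr E0 a0 E a ->
  stab muH E0 a0 W = stab mu E a (trace W) +
    [&& e0 \notin E, (gsrc e0 \in trace W) == (gtgt e0 \in trace W) &
        (q \in W) != (gsrc e0 \in trace W)]%:R.
Proof.
move=> [hE hs ht hq ha]; rewrite /stab sum_subdiv_vertex sum_subdiv_edge sum_edge.
rewrite hq muH_new subrr mulr0 addr0 -!addrA; congr (_ + _).
  by apply: eq_bigr => v _; rewrite ha muH_old inE.
congr (_ + _); first by apply: eq_bigr => e _; rewrite hE !inE.
rewrite hs ht !inE /edge_term /=.
by case: (e0 \in E); case: (q \in W); case: (_ \in W); case: (_ \in W) => /=; field.
Qed.

Lemma subdiv_balanced E0 a0 E a : subdiv_corr E0 a0 E a ->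
  balanced muH a0 <-> balanced mu a.
Proof.
move=> [_ _ _ hq ha]; rewrite /balanced !sum_subdiv_vertex hq muH_new !addr0.
rewrite (eq_bigr _ (fun v _ => congr1 intr (ha v))).
by rewrite (eq_bigr _ (fun v _ => muH_old v)).
Qed.

Lemma subdiv_bet_new E0 a0 : stab muH E0 a0 [set q]%SET =
  (a0 q)%:~R + (es \notin E0)%:R.
Proof.
rewrite /stab sum_subdiv_vertex sum_subdiv_edge big1 => [|v _]; last first.
  by rewrite inE mul0r.
rewrite big1 => [|e _]; last first.
  by rewrite !inE /edge_term; case: ifP; rewrite ?subrr mul0r.
rewrite !inE eqxx muH_new /edge_term /=.
by case: (es \in E0); case: (et \in E0) => /=; field.
Qed.

Lemma subdiv_bet_old E0 a0 : balanced muH a0 -> stab muH E0 a0 (~: [set q])%SET =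
  - (a0 q)%:~R + (et \notin E0)%:R.
Proof.
move=> /betC ->; rewrite sum_subdiv_vertex sum_subdiv_edge big1 => [|v _]; last first.
  by rewrite inE mul0r.
rewrite big1 => [|e _]; last first.
  by rewrite !inE /edge_term; case: ifP; rewrite ?subrr mul0r.
rewrite !inE eqxx muH_new /edge_term /=.
by case: (es \in E0); case: (et \in E0) => /=; field.
Qed.

(** Stability on the new vertex and on its complement bounds [a0 q] from both sides. If only one
    half carried a chip, this integer would lie strictly between two consecutive integers; otherwise
    only 0 is left. *)
Lemma subdiv_pst_new E0 a0 : pst muH E0 a0 -> balanced muH a0 ->
  (es \in E0) = (et \in E0) /\ a0 q = 0.
Proof.
move=> p b; have [h1 h1'] := p [set q]%SET; have [h2 h2'] := p (~: [set q])%SET.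
have cut e (W : {set gV H}) : e \in cut_edges W -> e \notin E0 ->
    ~~ (cut_edges W \subset E0).
  by move=> eW eE; apply/subsetPn; exists e.
have cs : es \in cut_edges [set q]%SET by rewrite !inE eqxx.
have ct : et \in cut_edges [set q]%SET by rewrite !inE eqxx.
have cs' : es \in cut_edges (~: [set q])%SET by rewrite !inE eqxx.
have ct' : et \in cut_edges (~: [set q])%SET by rewrite !inE eqxx.
move: h1 h1' h2 h2' (cut _ _ cs) (cut _ _ ct) (cut _ _ cs') (cut _ _ ct').
rewrite subdiv_bet_new subdiv_bet_old //.
case: (es \in E0); case: (et \in E0) => /=.
- move=> h1 _ h2 _ _ _ _ _; split=> //; apply: (@intr_inj R); rewrite rmorph0; lra.
- move=> _ h1 _ h2 _ /(_ isT)/h1 {}h1 _ /(_ isT)/h2 {}h2; exfalso.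
  have k1 : 0 < a0 q by rewrite -(ltr0z R); lra.
  have k2 : a0 q < 1 by rewrite -(ltr_int R); lra.
  by lia.
- move=> _ h1 _ h2 /(_ isT)/h1 {}h1 _ /(_ isT)/h2 {}h2 _; exfalso.
  have k1 : -1 < a0 q by rewrite -(ltr_int R) rmorphN /=; lra.
  have k2 : a0 q < 0 by rewrite -(ltr_int R); lra.
  by lia.
- move=> _ h1 _ h2 /(_ isT)/h1 {}h1 _ /(_ isT)/h2 {}h2 _; split=> //.
  have k1 : -1 < a0 q by rewrite -(ltr_int R) rmorphN /=; lra.
  have k2 : a0 q < 1 by rewrite -(ltr_int R); lra.
  by lia.
Qed.

Lemma subdiv_corr_down E0 a0 : pst muH E0 a0 -> balanced muH a0 ->
  exists E a, [/\ pst mu E a, balanced mu a & subdiv_corr E0 a0 E a].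
Proof.
move=> p b; have [est a0q] := subdiv_pst_new p b.
pose E := [set e | [exists e' in E0, subdiv_proj e' == e]]%SET.
have hc : subdiv_corr E0 a0 E (fun v => a0 (inl v)).
  have hE e' : (subdiv_proj e' \in E) = (e' \in E0).
    rewrite inE; apply/exists_inP/idP => [[e'' + /eqP]|he]; last by exists e'.
    elim/subdiv_edge_ind: e''; elim/subdiv_edge_ind: e' => //=.
    - by move=> e f hf /val_inj <-.
    - by move=> e _ h; case: (@old_neq e).
    - by move=> e _ h; case: (@old_neq e).
    - by move=> e _ h; case: (@old_neq e).
    - by rewrite est.
    - by move=> e _ h; case: (@old_neq e).
    - by rewrite est.
  by split=> // [e||]; rewrite -hE.
exists E, (fun v => a0 (inl v)); split=> //; last exact/(subdiv_balanced hc).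
(* With the new vertex on the side of the source of [e0] the extra term of [subdiv_bet] vanishes,
   and if [e0] is cut then [et] is the half that crosses. *)
move=> V; pose W : {set gV H} := [set w | match w with inl v => v \in V
  | inr _ => gsrc e0 \in V end]%SET.
have WV : trace W = V by apply/setP => v; rewrite !inE.
have [h1 h2] := p W; move: h1 h2; rewrite (subdiv_bet W hc) WV !inE eqxx !andbF addr0.
move=> h1 h2; split=> // cV; apply: h2; have [e eV eE] := subsetPn cV.
have [hE hs ht _ _] := hc; apply/subsetPn; move: e eV eE.
elim/edge_ind => [e|]; rewrite inE => eV eE.
  by exists (inl e); rewrite ?hE // !inE.
by exists et; rewrite ?ht // !inE.
Qed.

Lemma subdiv_corr_up E a : pst mu E a -> balanced mu a ->
  exists E0 a0, [/\ pst muH E0 a0, balanced muH a0 & subdiv_corr E0 a0 E a].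
Proof.
move=> p b.
pose E0 := [set e | subdiv_proj e \in E]%SET.
pose a0 (w : gV H) := if w is inl v then a v else 0.
have hc : subdiv_corr E0 a0 E a by split=> *; rewrite ?inE.
exists E0, a0; split=> //; last exact/(subdiv_balanced hc).
move=> W; have [h1 h2] := p (trace W); rewrite (subdiv_bet W hc); split.
  by rewrite addr_ge0.
have [/h2 h _|cV cW] := boolP (~~ (cut_edges (trace W) \subset E)).
  by rewrite ltr_wpDr.
(* The cut of the trace lies in [E], so the offending edge is a half of an uncut, chip-free [e0].
   The new vertex is then separated from both ends, and the extra term equals 1. *)
rewrite ltr_wpDl //.
move/negPn/fintype.subsetP: cV => cV; have [e eW eE] := subsetPn cW.
have [hE hs ht _ _] := hc; move: e eW eE; elim/subdiv_edge_ind => [e||]; rewrite inE.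
- move=> eW; rewrite hE => eE; have := cV (val e); rewrite !inE eW => /(_ isT).
  by rewrite (negbTE eE).
- move=> eW; rewrite hs => eE; have := cV e0; rewrite (negbTE eE) => h.
  have : e0 \notin cut_edges (trace W) by apply/negP => /h.
  rewrite !inE negbK => /eqP st; rewrite st eqxx /= -st.
  by move: eW => /=; rewrite eq_sym => ->.
- move=> eW; rewrite ht => eE; have := cV e0; rewrite (negbTE eE) => h.
  have : e0 \notin cut_edges (trace W) by apply/negP => /h.
  by rewrite !inE negbK => /eqP st; rewrite st eqxx /=; move: eW => /= ->.
Qed.

Lemma subdiv_corr_cell E0 a0 E a x : subdiv_corr E0 a0 E a ->
  cell_K lenH E0 x -> cell_K len E (x *m proj_mx).
Proof.
move=> [hE hs ht _ _] hx; elim/edge_ind => [e|].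
  by rewrite coord_proj_old -hE -lenH_old; exact: hx.
rewrite coord_proj_new; have := hx es; have := hx et.
rewrite hs ht lenH_src lenH_tgt; case: (e0 \in E) => -[h1 h2] [h3 h4]; split=> //.
  move=> _; have /andP[? ?] := h1 isT; have /andP[? ?] := h3 isT.
  by apply/andP; split; lra.
by move=> _; rewrite h2 // h4 // addr0.
Qed.

Lemma subdiv_corr_cell_onto E0 a0 E a x : subdiv_corr E0 a0 E a ->
  cell_K len E x -> exists2 x0, cell_K lenH E0 x0 & x0 *m proj_mx = x.
Proof.
move=> [hE hs ht _ _] hx; have l0 := len_gt0 e0; have /andP[y0_gt0 y0_lt] := hy0.
(* The coordinate of [e0] is distributed over the halves in proportion to their lengths, so both
   stay within bounds. *)
pose z := coord x e0 / len e0.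
have zE : z * len e0 = coord x e0 by rewrite /z divfK // gt_eqF.
pose f (e : gE H) := match e with
  | inl e => coord x (val e)
  | inr (_, false) => z * y0
  | inr (_, true) => z * (len e0 - y0) end.
have z01 : e0 \in E -> 0 <= z /\ z <= 1.
  move=> /(hx e0).1 /andP[h1 h2].
  by rewrite /z ler_pdivlMr // mul0r ler_pdivrMr // mul1r.
have z0 : e0 \notin E -> z = 0 by move=> /(hx e0).2; rewrite /z => ->; rewrite mul0r.
exists (vec f).
  elim/subdiv_edge_ind => [e||]; rewrite coord_vec /=.
  - by rewrite hE lenH_old; exact: hx.
  - rewrite hs lenH_src; split=> [/z01[h1 h2]|/z0 ->]; last by rewrite mul0r.
    by apply/andP; split; nra.
  - rewrite ht lenH_tgt; split=> [/z01[h1 h2]|/z0 ->]; last by rewrite mul0r.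
    by apply/andP; split; nra.
apply: coord_inj; elim/edge_ind => [e|].
  by rewrite coord_proj_old coord_vec.
by rewrite coord_proj_new !coord_vec /= -zE; ring.
Qed.

(** The first half dictates the potential at the new vertex; the second half is then consistent
    because [f e0] is the sum over both. *)
Lemma subdiv_potential (w : gE H -> R) (f : gE G -> R) :
  (forall e, f (val e) = w (inl e)) -> f e0 = w es + w et ->
  (exists phi, forall e, w e = phi (gtgt e) - phi (gsrc e)) <->
  (exists phi, forall e, f e = phi (gtgt e) - phi (gsrc e)).
Proof.
move=> hf hf0; split=> [[phi h]|[phi h]].
  exists (fun v => phi (inl v)); elim/edge_ind => [e|]; first by rewrite hf h.
  by rewrite hf0 !h /=; ring.
exists (fun v : gV H => if v is inl v then phi v else phi (gsrc e0) + w es).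
elim/subdiv_edge_ind => [e||] /=; first by rewrite -hf h.
  by rewrite addrC addrA addNr add0r.
by have := h e0; rewrite hf0 => h0; rewrite -[w et](addKr (w es)) h0; ring.
Qed.

Lemma subdiv_corr_L E0 a0 E a w : subdiv_corr E0 a0 E a ->
  (forall e, e \notin E0 -> coord w e = 0) ->
  (w *m proj_mx <= L_ E)%MS <-> (w <= L_ E0)%MS.
Proof.
move=> [hE hs ht _ _] hw.
have [p1 p2] := @subdiv_potential (coord w) (coord (w *m proj_mx))
  (@coord_proj_old w) (coord_proj_new w).
split=> /L_P[phi h]; apply/L_P.
  have [phi' h'] := p2 (ex_intro _ phi (fun e => (h e).1)).
  by exists phi' => e; split=> // /hw.
have [phi' h'] := p1 (ex_intro _ phi (fun e => (h e).1)).
exists phi' => e; split; first exact: h'.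
move: e {h h'}; elim/edge_ind => [e|] eE; first by rewrite coord_proj_old hw // hE.
by rewrite coord_proj_new !hw ?hs ?ht // addr0.
Qed.

Lemma subdiv_bd_new (k : gE H -> int) : boundary k q = k es - k et.
Proof.
rewrite /boundary sum_subdiv_edge big1 => [|e _]; last by rewrite /= subrr mulr0.
have -> : (gtgt es == q) = true by exact: eqxx.
by rewrite /=; ring.
Qed.

Lemma subdiv_bd (c : gE G -> int) :
  (forall v, boundary (fun e => c (subdiv_proj e)) (inl v : gV H) = boundary c v) /\
  boundary (fun e => c (subdiv_proj e)) q = 0.
Proof.
split=> [v|]; last by rewrite subdiv_bd_new subrr.
rewrite /boundary sum_subdiv_edge sum_edge; congr (_ + _).
have inlE (u : gV G) : (inl u == inl v :> gV H) = (u == v) by [].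
by rewrite /= !inlE; ring.
Qed.

Lemma subdiv_corr_lin E0 a0 E a x E0' a0' E' a' x' :
  subdiv_corr E0 a0 E a -> subdiv_corr E0' a0' E' a' ->
  lin_equiv lenH a0 x a0' x' <-> lin_equiv len a (x *m proj_mx) a' (x' *m proj_mx).
Proof.
move=> [_ _ _ hq ha] [_ _ _ hq' ha'].
have key (c : gE G -> int) :
    (exists phi, forall e, (c (subdiv_proj e))%:~R * lenH e + coord x' e - coord x e
        = phi (gtgt e) - phi (gsrc e)) <->
    (exists phi, forall e, (c e)%:~R * len e + coord (x' *m proj_mx) e -
        coord (x *m proj_mx) e = phi (gtgt e) - phi (gsrc e)).
  apply: subdiv_potential => [e|]; first by rewrite !coord_proj_old lenH_old.
  by rewrite !coord_proj_new lenH_src lenH_tgt /=; ring.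
split=> [[k [phi [h1 h2]]]|[c [phi [h1 h2]]]]; last first.
  have [phi' h'] := (key c).2 (ex_intro _ phi h2).
  exists (fun e => c (subdiv_proj e)), phi'; split=> //.
  have [b1 b2] := subdiv_bd c.
  elim/subdiv_vertex_ind => [v|]; first by rewrite b1 ha ha' h1.
  by rewrite b2 hq hq' subrr.
pose c e := if e == e0 then k et else oapp (fun e => k (inl e)) 0 (insub e).
(* Both divisors vanish at the new vertex, so the flow has no boundary there and passes to [e0] with
   a single slope. *)
have kst : k es = k et.
  by have := h1 q; rewrite hq hq' subrr subdiv_bd_new => /esym/subr0_eq.
have kc : k =1 fun e => c (subdiv_proj e).
  elim/subdiv_edge_ind => [e||]; rewrite /c /= ?eqxx //.
  have /negbTE -> : val e != e0 by [have := valP e; rewrite inE].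
  by rewrite valK.
have [phi' h'] := (key c).1 (ex_intro _ phi
  (fun e => etrans (congr1 (fun n => n%:~R * _ + _ - _) (esym (kc e))) (h2 e))).
exists c, phi'; split=> // v.
by rewrite -ha -ha' h1 -(subdiv_bd c).1; apply: eq_bd.
Qed.

Lemma refinement_subdiv (v0 : gV H) : connected_graph H ->
  \sum_v mu v = d%:~R ->
  exists f : pc_space (J_complex lenH d muH v0) -> pc_space (P_complex len d mu),
    refinement_map f.
Proof.
move=> conn sum_mu; have /andP[y0_gt0 y0_lt] := hy0.
have lenH_gt0 e : 0 < lenH e.
  elim/subdiv_edge_ind: e => [e||]; rewrite ?lenH_old ?lenH_src ?lenH_tgt //.
  by rewrite subr_gt0.
have sum_muH : \sum_v muH v = d%:~R.
  by rewrite sum_subdiv_vertex muH_new addr0 -sum_mu; apply: eq_bigr.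
exact: (transfer_refinement v0 lenH_gt0 len_gt0 conn sum_muH sum_mu
  subdiv_corr_down subdiv_corr_up subdiv_corr_cell subdiv_corr_cell_onto
  subdiv_corr_lin subdiv_corr_L).
Qed.

End Subdivision.

(** * The degree of the polarization and the refinement for a tropical curve *)

Lemma fsbig_finType (R : nmodType) (T : finType) (F : T -> R) :
  \sum_(x \in [set: T]) F x = \sum_x F x.
Proof.
rewrite [RHS]fsbig_seq ?index_enum_uniq //; apply: eq_fsbigl.
by apply/seteqP; split=> // v _ /=; rewrite mem_index_enum.
Qed.

(** Every point of the support of [mu] is a vertex of the [mu]-model, so the sum over the curve
    reduces to the vertices. *)
Lemma sum_mu_at (R : realType) (X : tropical_curve R) (d : int) (mu : X -> R)
    (G : model X) : polarization d mu -> mu_model mu G ->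
  \sum_v @mu_at R X mu G v = d%:~R.
Proof.
move=> [_ <-] hG; have [_ _ _ vinj _ _ _ _] := mglue G.
have -> : \sum_(p \in [set: X]) mu p = \sum_(p \in range (@mvx R X G)) mu p.
  apply/esym/fsbig_widen => // p [_ /= np]; apply: contrapT => mup.
  by apply: np; have : mu_vertices mu p by [right; right]; rewrite -hG.
rewrite fsbig_image; last by move=> u v _ _; exact: vinj.
exact: (esym (fsbig_finType _)).
Qed.

Theorem proposition6p7 (R : realType) (X : tropical_curve R) (d : int)
    (mu : X -> R) (hmu : polarization d mu) (hne : mu_vertices mu !=set0)
    (p0 : X) (G : model X) (hG : mu_model mu G)
    (G0 : model X) (v0 : gV G0) (hG0 : add_vertex G p0 v0) :
  exists f : pc_space (J_trop d mu v0) -> pc_space (P_trop d mu G),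
    refinement_map f.
Proof.
have sum_mu := sum_mu_at hmu hG.
have [len_gt0 _ _ _ _ ed_vx _ _] := mglue G.
case: hG0 => [v|e x hx v hv].
  exact: refinement_same_graph (mconn G) sum_mu.
apply: (@refinement_subdiv _ _ (@mu_at R X mu G) (@mlen _ _ G) d len_gt0 e x hx) => //.
(* The added point is interior to an edge, hence not a vertex of the [mu]-model, so [mu] vanishes
   there. *)
- move=> e' /=; apply: contrapT => mup.
  have : mu_vertices mu (med e x) by right; right.
  by rewrite -hG => -[u _ /esym]; exact: ed_vx.
- exact: mconn (split_model hx).
Qed.
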